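(* Let $\mathcal{K}$ be a rooted $2$-tree with root $w$. Then the independence graph $\Gamma(\mathcal{K},w)$ is appropriate; that is, for every family $\{G_v\}$ of diagram groups indexed by the vertices $v$ of $\Gamma(\mathcal{K},w)$, the graph product of the groups $G_v$ over $\Gamma(\mathcal{K},w)$ is again a diagram group.
   Context: A directed $2$-complex $\mathcal{K}$ consists of: a directed graph (each edge $e$ has an initial vertex $\iota(e)$ and a terminal vertex $\tau(e)$); a set of $2$-cells; for each $2$-cell $f$, two nonempty directed paths $\lceil f\rceil$ (top) and $\lfloor f\rfloor$ (bottom) in the graph with the same initial vertex and the same terminal vertex; and a fixed-point-free involution $f\mapsto f^{-1}$ on $2$-cells with $\lceil f^{-1}\rceil=\lfloor f\rfloor$, $\lfloor f^{-1}\rfloor=\lceil f\rceil$. A $1$-path is a (possibly empty) directed path in the graph. The Squier complex $\mathrm{Sq}(\mathcal{K})$ is the $2$-dimensional cell complex whose vertices are the nonempty $1$-paths; whose edges are the triples $(p,f,q)$, with $p,q$ $1$-paths and $f$ a $2$-cell such that $p\lceil f\rceil q$ is a $1$-path, going from $p\lceil f\rceil q$ to $p\lfloor f\rfloor q$, with $(p,f,q)^{-1}=(p,f^{-1},q)$; and which has, for every $(p,f,q,g,r)$ with $f,g$ $2$-cells and $p\lceil f\rceil q\lceil g\rceil r$ a $1$-path, a $2$-cell attached along the loop $(p,f,q\lceil g\rceil r)\,(p\lfloor f\rfloor q,g,r)\,(p,f,q\lfloor g\rfloor r)^{-1}\,(p\lceil f\rceil q,g,r)^{-1}$. For a nonempty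 $1$-path $w$, the diagram group is $\mathcal{D}(\mathcal{K},w)=\pi_1(\mathrm{Sq}(\mathcal{K}),w)$; a diagram group is a group isomorphic to some $\mathcal{D}(\mathcal{K},w)$. Two $1$-paths are homotopic in $\mathcal{K}$ if they are equal or are joined by an edge path in $\mathrm{Sq}(\mathcal{K})$. A rooted $2$-tree with root $w$ ($w$ a nonempty $1$-path) is a directed $2$-complex $\mathcal{K}$ such that: (T1) for any vertex $o$ of $\mathcal{K}$ there exists a $1$-path from $\iota(w)$ to $\tau(w)$ containing $o$; (T2) every two $1$-paths in $\mathcal{K}$ with the same endpoints are homotopic in $\mathcal{K}$; (T3) the diagram group $\mathcal{D}(\mathcal{K},w)$ is trivial. The independence graph $\Gamma(\mathcal{K},w)$ has as vertices all edges of $\mathcal{K}$ that belong to $1$-paths homotopic to $w$; two distinct edges $e_1,e_2$ are adjacent if and only if they are independent, i.e. there exists a $1$-path in $\mathcal{K}$ homotopic to $w$ that contains both $e_1$ and $e_2$. The graph product of a family of groups $\{G_v\}_{v\in V}$ over a graph with vertex set $V$ is the quotient of the free product $\ast_{v\in V}G_v$ by the normal subgroup generated by all commutators $[g,h]$ with $g\in G_s$, $h\in G_t$, where $s,t$ are adjacent vertices. *)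

(* Defs.v *)
From HB Require Import structures.
From mathcomp Require Import all_boot generic_quotient.
From mathcomp Require Import boolp.
From Stdlib Require List.
From Stdlib Require Import Relation_Operators.

Set Implicit Arguments.
Unset Strict Implicit.
Unset Printing Implicit Defensive.

Local Open Scope group_scope.

(** Arbitrary (possibly infinite) groups are MathComp's [groupType]s; the
    choice structure this requires is supplied classically. *)

Definition isomorphic (G H : groupType) : Prop :=
  exists f : G -> H, {morph f : x y / x * y} /\ bijective f.

(** A type with operations satisfying the group axioms up to an equivalence
    relation; [quot_group] is the group of its equivalence classes. *)
Record pregroup : Type := PreGroup {
  pg_sort :> Type;
  pg_eq : pg_sort -> pg_sort -> Prop;
  pg_mul : pg_sort -> pg_sort -> pg_sort;
  pg_one : pg_sort;
  pg_inv : pg_sort -> pg_sort;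
  pg_refl : forall x, pg_eq x x;
  pg_sym : forall x y, pg_eq x y -> pg_eq y x;
  pg_trans : forall x y z, pg_eq x y -> pg_eq y z -> pg_eq x z;
  pg_mul_eq : forall x x' y y',
    pg_eq x x' -> pg_eq y y' -> pg_eq (pg_mul x y) (pg_mul x' y');
  pg_inv_eq : forall x x', pg_eq x x' -> pg_eq (pg_inv x) (pg_inv x');
  pg_mulA : forall x y z,
    pg_eq (pg_mul x (pg_mul y z)) (pg_mul (pg_mul x y) z);
  pg_mul1 : forall x, pg_eq (pg_mul pg_one x) x;
  pg_1mul : forall x, pg_eq (pg_mul x pg_one) x;
  pg_mulV : forall x, pg_eq (pg_mul (pg_inv x) x) pg_one;
  pg_Vmul : forall x, pg_eq (pg_mul x (pg_inv x)) pg_one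
}.

Section QuotGroup.
Variable P : pregroup.

Definition pg_rel (x y : {classic P}) : bool := `[< @pg_eq P x y >].

Lemma pg_relP : equiv_class_of pg_rel.
Proof.
split=> [x | x y | y x z].
- exact/asboolP/pg_refl.
- by apply/asboolP/asboolP; exact: pg_sym.
- by move=> /asboolP xy /asboolP yz; apply/asboolP; exact: pg_trans xy yz.
Qed.

Canonical pg_equiv := EquivRelPack pg_relP.

Definition quot_sort : Type := {eq_quot pg_equiv}%qT.
HB.instance Definition _ := Choice.on quot_sort.

Definition quot_class (x : P) : quot_sort := (\pi_({eq_quot pg_equiv}) x)%qT.

Lemma quot_classP (x y : P) : quot_class x = quot_class y <-> pg_eq x y.
Proof.
split=> [/eqmodP /asboolP // | xy]; by apply/eqmodP/asboolP.
Qed.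

Definition quot_repr (c : quot_sort) : P := repr (c : {eq_quot pg_equiv}%qT).

Lemma quot_reprK c : quot_class (quot_repr c) = c.
Proof. exact: (@reprK _ {eq_quot pg_equiv}%qT). Qed.

Lemma quot_ind (Q : quot_sort -> Prop) :
  (forall x, Q (quot_class x)) -> forall c, Q c.
Proof. by move=> QP c; rewrite -(quot_reprK c). Qed.

Lemma quot_repr_class (x : P) : pg_eq (quot_repr (quot_class x)) x.
Proof. by apply/quot_classP; rewrite quot_reprK. Qed.

Definition quot_mul (c d : quot_sort) : quot_sort :=
  quot_class (pg_mul (quot_repr c) (quot_repr d)).
Definition quot_one : quot_sort := quot_class (pg_one P).
Definition quot_inv (c : quot_sort) : quot_sort :=
  quot_class (pg_inv (quot_repr c)).

Lemma quot_mulE x y :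
  quot_mul (quot_class x) (quot_class y) = quot_class (pg_mul x y).
Proof. by apply/quot_classP; apply: pg_mul_eq; exact: quot_repr_class. Qed.

Lemma quot_invE x : quot_inv (quot_class x) = quot_class (pg_inv x).
Proof. by apply/quot_classP; apply: pg_inv_eq; exact: quot_repr_class. Qed.

Lemma quot_mulA : associative quot_mul.
Proof.
elim/quot_ind=> x; elim/quot_ind=> y; elim/quot_ind=> z.
by rewrite !quot_mulE; apply/quot_classP/pg_mulA.
Qed.

Lemma quot_mul1 : left_id quot_one quot_mul.
Proof. by elim/quot_ind=> x; rewrite quot_mulE; apply/quot_classP/pg_mul1. Qed.

Lemma quot_1mul : right_id quot_one quot_mul.
Proof. by elim/quot_ind=> x; rewrite quot_mulE; apply/quot_classP/pg_1mul. Qed.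

Lemma quot_mulV : left_inverse quot_one quot_inv quot_mul.
Proof.
by elim/quot_ind=> x; rewrite quot_invE quot_mulE; apply/quot_classP/pg_mulV.
Qed.

Lemma quot_Vmul : right_inverse quot_one quot_inv quot_mul.
Proof.
by elim/quot_ind=> x; rewrite quot_invE quot_mulE; apply/quot_classP/pg_Vmul.
Qed.

HB.instance Definition _ :=
  isGroup.Build quot_sort quot_mulA quot_mul1 quot_1mul quot_mulV quot_Vmul.

Definition quot_group : groupType := quot_sort.

End QuotGroup.

Inductive normal_closure (G : groupType) (S : G -> Prop) : G -> Prop :=
| nc_gen x : S x -> normal_closure S x
| nc_one : normal_closure S 1
| nc_mul x y :
    normal_closure S x -> normal_closure S y -> normal_closure S (x * y)
| nc_inv x : normal_closure S x -> normal_closure S x^-1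
| nc_conj x y : normal_closure S x -> normal_closure S (x ^ y).

Section QuotClosure.
Variables (G : groupType) (S : G -> Prop).

Definition nc_eq (x y : G) : Prop := normal_closure S (x^-1 * y).

Lemma nc_eq_refl x : nc_eq x x.
Proof. by rewrite /nc_eq mulVg; exact: nc_one. Qed.

Lemma nc_eq_sym x y : nc_eq x y -> nc_eq y x.
Proof. by move=> /nc_inv; rewrite /nc_eq invgM invgK. Qed.

Lemma nc_eq_trans x y z : nc_eq x y -> nc_eq y z -> nc_eq x z.
Proof. by move=> xy /(nc_mul xy); rewrite /nc_eq -!mulgA mulVKg. Qed.

Lemma nc_eq_mul x x' y y' : nc_eq x x' -> nc_eq y y' -> nc_eq (x * y) (x' * y').
Proof.
move=> xx yy; have := nc_mul (nc_conj y xx) yy.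
by rewrite /nc_eq /conjg invgM -!mulgA mulVKg.
Qed.

Lemma nc_eq_inv x x' : nc_eq x x' -> nc_eq x^-1 x'^-1.
Proof.
move=> /nc_inv /(nc_conj x^-1); rewrite /nc_eq /conjg invgM !invgK.
by rewrite -!mulgA mulgV mulg1.
Qed.

Definition nc_pregroup : pregroup.
Proof.
refine (@PreGroup G nc_eq *%g 1 inv nc_eq_refl nc_eq_sym nc_eq_trans
          nc_eq_mul nc_eq_inv _ _ _ _ _) => *.
- by rewrite mulgA; exact: nc_eq_refl.
- by rewrite mul1g; exact: nc_eq_refl.
- by rewrite mulg1; exact: nc_eq_refl.
- by rewrite mulVg; exact: nc_eq_refl.
- by rewrite mulgV; exact: nc_eq_refl.
Defined.

Definition quot_closure : groupType := quot_group nc_pregroup.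

End QuotClosure.

(** The free product is the set of words in the disjoint union of the groups,
    up to the multiplication tables of the groups; each identity element is
    identified with the empty word. *)
Section FreeProduct.
Variables (V : Type) (G : V -> groupType).

Definition letter : Type := {v : V & G v}.
Definition mkletter (v : V) (g : G v) : letter := existT (fun u => G u : Type) v g.

Inductive fp_step : seq letter -> seq letter -> Prop :=
| fp_step1 (a b : seq letter) (v : V) :
    fp_step (a ++ mkletter (1 : G v) :: b) (a ++ b)
| fp_stepM (a b : seq letter) (v : V) (g h : G v) :
    fp_step (a ++ [:: mkletter g, mkletter h & b]) (a ++ mkletter (g * h) :: b).

Definition fp_eq : seq letter -> seq letter -> Prop :=
  clos_refl_sym_trans _ fp_step.

Definition letter_inv (x : letter) : letter := mkletter (projT2 x)^-1.
Definition fp_inv (s : seq letter) : seq letter := rev (map letter_inv s).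

Lemma fp_eq_cat2 c s t d : fp_eq s t -> fp_eq (c ++ s ++ d) (c ++ t ++ d).
Proof.
elim=> [x y xy | x | x y _ | x y z _ xy _ yz].
- apply: rst_step; case: xy => [a b v | a b v g h].
  + have := fp_step1 (c ++ a) (b ++ d) v.
    by rewrite -!catA.
  + have := fp_stepM (c ++ a) (b ++ d) g h.
    by rewrite -!catA.
- exact: rst_refl.
- exact: rst_sym.
- exact: rst_trans xy yz.
Qed.

Lemma fp_eq_cat s s' t t' :
  fp_eq s s' -> fp_eq t t' -> fp_eq (s ++ t) (s' ++ t').
Proof.
move=> ss tt; apply: (rst_trans _ _ _ (s' ++ t)).
  exact: (@fp_eq_cat2 [::] _ _ t).
by have := fp_eq_cat2 s' [::] tt; rewrite !cats0.
Qed.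

Lemma fp_eq_inv s t : fp_eq s t -> fp_eq (fp_inv s) (fp_inv t).
Proof.
elim=> [x y xy | x | x y _ | x y z _ xy _ yz].
- apply: rst_step; case: xy => [a b v | a b v g h];
    rewrite /fp_inv !map_cat /= !rev_cat !rev_cons -!cats1 -!catA /=.
  + by rewrite /letter_inv /= invg1; exact: fp_step1.
  + by rewrite /letter_inv /= invgM; exact: fp_stepM.
- exact: rst_refl.
- exact: rst_sym.
- exact: rst_trans xy yz.
Qed.

Lemma fp_invK : involutive fp_inv.
Proof.
move=> s; rewrite /fp_inv map_rev revK -map_comp.
rewrite (eq_map (g := id)) ?map_id // => -[v g].
by rewrite /= /letter_inv /= invgK.
Qed.

Lemma fp_eq_Vmul s : fp_eq (s ++ fp_inv s) [::].
Proof.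
elim: s => [|[v g] s IH]; first exact: rst_refl.
rewrite /fp_inv /= rev_cons -cats1 catA.
have e := fp_eq_cat2 [:: mkletter g] [:: mkletter g^-1] IH.
apply: rst_trans e _ => /=; apply: (rst_trans _ _ _ [:: mkletter (g * g^-1)]).
  exact/rst_step/(fp_stepM [::] [::]).
by rewrite mulgV; exact/rst_step/(fp_step1 [::] [::]).
Qed.

Lemma fp_eq_mulV s : fp_eq (fp_inv s ++ s) [::].
Proof. by have := fp_eq_Vmul (fp_inv s); rewrite fp_invK. Qed.

Definition fp_pregroup : pregroup.
Proof.
refine (@PreGroup (seq letter) fp_eq cat [::] fp_inv (rst_refl _ _)
         (rst_sym _ _) (rst_trans _ _) fp_eq_cat fp_eq_inv _ _ _
         fp_eq_mulV fp_eq_Vmul) => *.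
- by rewrite catA; exact: rst_refl.
- exact: rst_refl.
- by rewrite cats0; exact: rst_refl.
Defined.

Definition free_product : groupType := quot_group fp_pregroup.

Definition fp_in (v : V) (g : G v) : free_product :=
  @quot_class fp_pregroup [:: mkletter g].

End FreeProduct.

Record graph : Type := Graph {
  vert : Type;
  adj : vert -> vert -> Prop;
  adj_irr : forall v, ~ adj v v;
  adj_sym : forall u v, adj u v -> adj v u
}.

Inductive graph_commutator (Gam : graph) (G : vert Gam -> groupType) :
    free_product G -> Prop :=
| GraphCommutator (s t : vert Gam) (g : G s) (h : G t) :
    adj s t -> graph_commutator [~ fp_in g, fp_in h].

Definition graph_product (Gam : graph) (G : vert Gam -> groupType) : groupType :=
  quot_closure (@graph_commutator Gam G).

Record digraph : Type := Digraph {
  vertex : Type;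
  edge : Type;
  init : edge -> vertex;
  term : edge -> vertex
}.

Fixpoint walk (D : digraph) (x : vertex D) (s : seq (edge D)) (y : vertex D) :
    Prop :=
  if s is e :: s' then init e = x /\ walk (term e) s' y else x = y.

Lemma walk_cat (D : digraph) (x y z : vertex D) s t :
  walk x s y -> walk y t z -> walk x (s ++ t) z.
Proof.
by elim: s x => [|e s IH] x /= => [-> //|[ex sy] tz]; split=> //; exact: IH.
Qed.

(** The endpoints are part of a 1-path, so that there is one empty 1-path at
    each vertex. *)
Record path1 (D : digraph) : Type := Path1 {
  psrc : vertex D;
  pseq :> seq (edge D);
  ptgt : vertex D;
  pwalk : walk psrc pseq ptgt
}.

Lemma path1_eq (D : digraph) (p q : path1 D) :
  psrc p = psrc q -> pseq p = pseq q -> ptgt p = ptgt q -> p = q.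
Proof.
case: p q => [x s y w] [x' s' y' w'] /= ex es ey; subst x' s' y'.
by rewrite (Prop_irrelevance w w').
Qed.

Definition pverts (D : digraph) (p : path1 D) : seq (vertex D) :=
  psrc p :: map (@term D) p.

Definition pcat (D : digraph) (p q : path1 D) (h : ptgt p = psrc q) : path1 D :=
  Path1 (walk_cat (pwalk p)
    (eq_ind_r (fun x => walk x (pseq q) (ptgt q)) (pwalk q) h)).

Record nepath (D : digraph) : Type := NePath {
  np_path :> path1 D;
  np_neq0 : pseq np_path <> [::]
}.

Lemma nepath_eq (D : digraph) (p q : nepath D) :
  np_path p = np_path q -> p = q.
Proof.
case: p q => [p p0] [q q0] /= e; subst q.
by rewrite (Prop_irrelevance p0 q0).
Qed.

(** Combinatorial 2-dimensional cell complexes: every geometric edge of the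
    1-skeleton occurs with both orientations, so that an edge path is a [walk];
    2-cells are attached along edge loops. *)

Record cell_complex : Type := CellComplex {
  cc_graph :> digraph;
  einv : edge cc_graph -> edge cc_graph;
  einvK : involutive einv;
  einv_neq : forall e, einv e <> e;
  init_einv : forall e, init (einv e) = term e;
  cell : Type;
  attach : cell -> path1 cc_graph;
  attach_loop : forall c, psrc (attach c) = ptgt (attach c)
}.

Section FundamentalGroup.
Variables (X : cell_complex) (x : vertex X).

Record loop : Type := Loop {
  lseq :> seq (edge X);
  lwalk : walk x lseq x
}.

(** The fundamental group is combinatorial: loops up to insertion and removal
    of a pair of mutually inverse edges or of the boundary loop of a 2-cell. *)
Inductive loop_step (l m : loop) : Prop :=
| loop_step_inv (a b : seq (edge X)) (e : edge X) :
    lseq l = a ++ [:: e, einv e & b] -> lseq m = a ++ b -> loop_step l m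
| loop_step_cell (a b : seq (edge X)) (c : cell X) :
    lseq l = a ++ attach c ++ b -> lseq m = a ++ b -> loop_step l m.

Definition loop_eq : loop -> loop -> Prop := clos_refl_sym_trans _ loop_step.

Lemma term_einv (e : edge X) : term (einv e) = init e.
Proof. by rewrite -init_einv einvK. Qed.

Lemma walk_cancel (y z : vertex X) (e : edge X) s t :
  walk y (s ++ [:: e, einv e & t]) z -> walk y (s ++ t) z.
Proof.
elim: s y => [|e' s IH] y /=; first by rewrite term_einv => -[<- []].
by case=> -> /IH.
Qed.

Lemma walk_rev (y z : vertex X) s :
  walk y s z -> walk z (rev (map (@einv X) s)) y.
Proof.
elim: s y => [|e s IH] y /= => [-> //|[ey sz]].
rewrite rev_cons -cats1; apply: walk_cat (IH _ sz) _.
by split; [exact: init_einv | rewrite term_einv].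
Qed.

Definition loop_mul (l m : loop) : loop := Loop (walk_cat (lwalk l) (lwalk m)).
Definition loop_one : loop := @Loop [::] erefl.
Definition loop_inv (l : loop) : loop := Loop (walk_rev (lwalk l)).

Lemma loop_ext (l m : loop) : lseq l = lseq m -> l = m.
Proof.
case: l m => [s w] [s' w'] /= e; subst s'.
by rewrite (Prop_irrelevance w w').
Qed.

Lemma loop_eq_mulr l m n : loop_eq l m -> loop_eq (loop_mul l n) (loop_mul m n).
Proof.
elim=> [{}l {}m lm | ? | ? ? _ | ? ? ? _ xy _ yz].
- apply: rst_step; case: lm => [a b e | a b c] el em.
  + by apply: (@loop_step_inv _ _ a (b ++ n) e); rewrite /= ?el ?em -?catA.
  + by apply: (@loop_step_cell _ _ a (b ++ n) c); rewrite /= ?el ?em -?catA.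
- exact: rst_refl.
- exact: rst_sym.
- exact: rst_trans xy yz.
Qed.

Lemma loop_eq_mull l m n : loop_eq l m -> loop_eq (loop_mul n l) (loop_mul n m).
Proof.
elim=> [{}l {}m lm | ? | ? ? _ | ? ? ? _ xy _ yz].
- apply: rst_step; case: lm => [a b e | a b c] el em.
  + by apply: (@loop_step_inv _ _ (n ++ a) b e); rewrite /= ?el ?em -?catA.
  + by apply: (@loop_step_cell _ _ (n ++ a) b c); rewrite /= ?el ?em -?catA.
- exact: rst_refl.
- exact: rst_sym.
- exact: rst_trans xy yz.
Qed.

Lemma loop_eq_mul l l' m m' :
  loop_eq l l' -> loop_eq m m' -> loop_eq (loop_mul l m) (loop_mul l' m').
Proof.
move=> ll mm; apply: (rst_trans _ _ _ (loop_mul l' m)).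
  exact: loop_eq_mulr.
exact: loop_eq_mull.
Qed.

Lemma seq_cancel (s a b : seq (edge X)) (l m : loop) :
  lseq l = a ++ (s ++ rev (map (@einv X) s)) ++ b -> lseq m = a ++ b ->
  loop_eq l m.
Proof.
elim/last_ind: s l => [|s e IH] l el em.
  by rewrite (@loop_ext l m) ?el ?em //; exact: rst_refl.
have el' : lseq l =
    (a ++ s) ++ [:: e, einv e & rev (map (@einv X) s) ++ b].
  by rewrite el map_rcons rev_rcons -cats1 -!catA.
have wl : walk x (a ++ (s ++ rev (map (@einv X) s)) ++ b) x.
  have -> : a ++ (s ++ rev (map (@einv X) s)) ++ b =
      (a ++ s) ++ (rev (map (@einv X) s) ++ b) by rewrite -!catA.
  by apply: (@walk_cancel _ _ e); rewrite -el'; exact: lwalk.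
apply: (rst_trans _ _ _ (Loop wl)); last exact: IH.
by apply: rst_step; apply: loop_step_inv el' _; rewrite /= -!catA.
Qed.

Lemma loop_eq_Vmul l : loop_eq (loop_mul l (loop_inv l)) loop_one.
Proof. by apply: (@seq_cancel l [::] [::]) => //=; rewrite cats0. Qed.

Lemma loop_invK l : loop_inv (loop_inv l) = l.
Proof.
apply: loop_ext; rewrite /= map_rev revK -map_comp.
by rewrite (eq_map (g := id)) ?map_id // => e /=; exact: einvK.
Qed.

Lemma loop_eq_mulV l : loop_eq (loop_mul (loop_inv l) l) loop_one.
Proof. by have := loop_eq_Vmul (loop_inv l); rewrite loop_invK. Qed.

Lemma loop_mulA l m n : loop_mul l (loop_mul m n) = loop_mul (loop_mul l m) n.
Proof. by apply: loop_ext; rewrite /= catA. Qed.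

Lemma loop_mul1 l : loop_mul loop_one l = l.
Proof. exact: loop_ext. Qed.

Lemma loop_1mul l : loop_mul l loop_one = l.
Proof. by apply: loop_ext; rewrite /= cats0. Qed.

Lemma loop_eq_inv l m : loop_eq l m -> loop_eq (loop_inv l) (loop_inv m).
Proof.
move=> lm; rewrite -[loop_inv l]loop_1mul.
apply: (rst_trans _ _ _ (loop_mul (loop_inv l) (loop_mul m (loop_inv m)))).
  exact/loop_eq_mull/rst_sym/loop_eq_Vmul.
rewrite loop_mulA -{2}[loop_inv m]loop_mul1; apply: loop_eq_mulr.
apply: (rst_trans _ _ _ (loop_mul (loop_inv l) l)); last exact: loop_eq_mulV.
exact/loop_eq_mull/rst_sym.
Qed.

Definition pi1_pregroup : pregroup.
Proof.
refine (@PreGroup loop loop_eq loop_mul loop_one loop_inv (rst_refl _ _)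
         (rst_sym _ _) (rst_trans _ _) loop_eq_mul loop_eq_inv _ _ _
         loop_eq_mulV loop_eq_Vmul) => *.
- by rewrite loop_mulA; exact: rst_refl.
- by rewrite loop_mul1; exact: rst_refl.
- by rewrite loop_1mul; exact: rst_refl.
Defined.

Definition pi1 : groupType := quot_group pi1_pregroup.

End FundamentalGroup.

Record complex2 : Type := Complex2 {
  skeleton :> digraph;
  face : Type;
  top : face -> path1 skeleton;
  bot : face -> path1 skeleton;
  top_neq0 : forall f, pseq (top f) <> [::];
  bot_neq0 : forall f, pseq (bot f) <> [::];
  bot_src : forall f, psrc (bot f) = psrc (top f);
  bot_tgt : forall f, ptgt (bot f) = ptgt (top f);
  finv : face -> face;
  finvK : involutive finv;
  finv_neq : forall f, finv f <> f;
  top_finv : forall f, top (finv f) = bot f;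
  bot_finv : forall f, bot (finv f) = top f
}.

Section Squier.
Variable K : complex2.

Lemma cat3_neq0 (T : Type) (a b c : seq T) : b <> [::] -> (a ++ b) ++ c <> [::].
Proof. by case: a b => [|? ?] [|? ?]. Qed.

Record sq_edge : Type := SqEdge {
  sq_p : path1 K;
  sq_f : face K;
  sq_q : path1 K;
  sq_pf : ptgt sq_p = psrc (top sq_f);
  sq_fq : ptgt (top sq_f) = psrc sq_q
}.

Definition sq_init (e : sq_edge) : nepath K :=
  @NePath K (@pcat K (pcat (sq_pf e)) (sq_q e) (sq_fq e))
    (cat3_neq0 (a := pseq (sq_p e)) (c := pseq (sq_q e))
       (@top_neq0 K (sq_f e))).

Definition sq_term (e : sq_edge) : nepath K :=
  @NePath K
    (@pcat K (pcat (etrans (sq_pf e) (esym (bot_src (sq_f e)))))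
       (sq_q e) (etrans (bot_tgt (sq_f e)) (sq_fq e)))
    (cat3_neq0 (a := pseq (sq_p e)) (c := pseq (sq_q e))
       (@bot_neq0 K (sq_f e))).

Definition sq_graph : digraph := Digraph sq_init sq_term.

Lemma sq_edge_eq (e e' : sq_edge) :
  sq_p e = sq_p e' -> sq_f e = sq_f e' -> sq_q e = sq_q e' -> e = e'.
Proof.
case: e e' => [p f q h1 h2] [p' f' q' h1' h2'] /= ep ef eq; subst p' f' q'.
by rewrite (Prop_irrelevance h1 h1') (Prop_irrelevance h2 h2').
Qed.

Lemma sq_einv_pf (e : sq_edge) : ptgt (sq_p e) = psrc (top (finv (sq_f e))).
Proof. by rewrite top_finv bot_src sq_pf. Qed.

Lemma sq_einv_fq (e : sq_edge) : ptgt (top (finv (sq_f e))) = psrc (sq_q e).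
Proof. by rewrite top_finv bot_tgt sq_fq. Qed.

Definition sq_einv (e : sq_edge) : sq_edge :=
  SqEdge (sq_einv_pf e) (sq_einv_fq e).

Lemma sq_einvK : involutive sq_einv.
Proof. by move=> e; apply: sq_edge_eq => //=; exact: finvK. Qed.

Lemma sq_einv_neq e : sq_einv e <> e.
Proof. by move=> /(congr1 sq_f) /=; exact: finv_neq. Qed.

Lemma sq_init_einv e : sq_init (sq_einv e) = sq_term e.
Proof. by apply/nepath_eq/path1_eq => //=; rewrite top_finv. Qed.

(** The 2-cells [(p, f, q, g, r)], where [p top(f) q top(g) r] is a 1-path. *)
Record sq_cell : Type := SqCell {
  sc_p : path1 K;
  sc_f : face K;
  sc_q : path1 K;
  sc_g : face K;
  sc_r : path1 K;
  sc_pf : ptgt sc_p = psrc (top sc_f);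
  sc_fq : ptgt (top sc_f) = psrc sc_q;
  sc_qg : ptgt sc_q = psrc (top sc_g);
  sc_gr : ptgt (top sc_g) = psrc sc_r
}.

Section Attach.
Variable c : sq_cell.

Let p := sc_p c.
Let f := sc_f c.
Let q := sc_q c.
Let g := sc_g c.
Let r := sc_r c.

Let pf : ptgt p = psrc (top f) := sc_pf c.
Let fq : ptgt (top f) = psrc q := sc_fq c.
Let qg : ptgt q = psrc (top g) := sc_qg c.
Let gr : ptgt (top g) = psrc r := sc_gr c.
Let pf' : ptgt p = psrc (bot f) := etrans pf (esym (bot_src f)).
Let fq' : ptgt (bot f) = psrc q := etrans (bot_tgt f) fq.
Let qg' : ptgt q = psrc (bot g) := etrans qg (esym (bot_src g)).
Let gr' : ptgt (bot g) = psrc r := etrans (bot_tgt g) gr.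

(** The edges [(p, f, q top(g) r)], [(p bot(f) q, g, r)], [(p, f, q bot(g) r)]
    and [(p top(f) q, g, r)]. *)
Definition sq_e1 : sq_edge :=
  @SqEdge p f (@pcat K (pcat qg) r gr) pf fq.
Definition sq_e2 : sq_edge :=
  @SqEdge (@pcat K (pcat pf') q fq') g r qg gr.
Definition sq_e3 : sq_edge :=
  @SqEdge p f (@pcat K (pcat qg') r gr') pf fq.
Definition sq_e4 : sq_edge :=
  @SqEdge (@pcat K (pcat pf) q fq) g r qg gr.

Definition sq_boundary : seq sq_edge :=
  [:: sq_e1; sq_e2; sq_einv sq_e3; sq_einv sq_e4].

Lemma sq_boundary_walk :
  walk (D := sq_graph) (sq_init sq_e1) sq_boundary (sq_init sq_e1).
Proof.
rewrite /= !sq_init_einv; split=> //.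
by do !split; apply/nepath_eq/path1_eq; rewrite //= ?top_finv ?bot_finv -?catA.
Qed.

Definition sq_attach : path1 sq_graph := Path1 sq_boundary_walk.

End Attach.

Definition squier : cell_complex :=
  @CellComplex sq_graph sq_einv sq_einvK sq_einv_neq sq_init_einv
    sq_cell sq_attach (fun=> erefl).

End Squier.

Definition diagram_group (K : complex2) (w : nepath K) : groupType :=
  @pi1 (squier K) w.

Definition is_diagram_group (G : groupType) : Prop :=
  exists (K : complex2) (w : nepath K), isomorphic G (diagram_group w).

(** As [squier K] is closed under edge inversion, this is symmetric; an empty
    1-path is homotopic to itself only. *)
Definition homotopic (K : complex2) (p q : path1 K) : Prop :=
  p = q \/
  exists (P Q : nepath K) (s : seq (edge (squier K))),
    [/\ np_path P = p, np_path Q = q & walk (D := squier K) P s Q].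

Record rooted_2tree (K : complex2) (w : nepath K) : Prop := Rooted2Tree {
  rt_T1 : forall o : vertex K, exists p : path1 K,
    [/\ psrc p = psrc w, ptgt p = ptgt w & List.In o (pverts p)];
  rt_T2 : forall p q : path1 K,
    psrc p = psrc q -> ptgt p = ptgt q -> homotopic p q;
  rt_T3 : forall x : diagram_group w, x = 1
}.

Section Independence.
Variables (K : complex2) (w : nepath K).

Definition indep_vert : Type :=
  {e : edge K | exists p : path1 K, homotopic p w /\ List.In e p}.

Definition independent (e1 e2 : edge K) : Prop :=
  exists p : path1 K, [/\ homotopic p w, List.In e1 p & List.In e2 p].

Definition indep_adj (u v : indep_vert) : Prop :=
  sval u <> sval v /\ independent (sval u) (sval v).

Lemma indep_adj_irr v : ~ indep_adj v v.
Proof. by case. Qed.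

Lemma indep_adj_sym u v : indep_adj u v -> indep_adj v u.
Proof.
by case=> uv [p [pw up vp]]; split; [exact: nesym | exists p].
Qed.

Definition independence_graph : graph := Graph indep_adj_irr indep_adj_sym.

End Independence.

Definition appropriate (Gam : graph) : Prop :=
  forall G : vert Gam -> groupType,
    (forall v, is_diagram_group (G v)) -> is_diagram_group (graph_product G).

(* Main.v *)
(** Write [G_u = D(L_u, w_u)] for every vertex [u] of the independence graph,
    that is, for every edge of [K]. Let [K'] be the one-vertex complex obtained
    from [K] by replacing every edge [u] with a bracketed copy of [w_u] and by
    adding the 2-cells of all the [L_u]. The 1-paths of [K'] homotopic to the
    expansion of [w] are the sequences of bracketed blocks whose contraction is
    homotopic to [w] in [K], each block [u] containing a path homotopic to [w_u].
    A 2-cell of [K'] applied to such a path either acts inside one block [u],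
    where it contributes an element of [G_u], or comes from [K] and contributes
    nothing. Two blocks occurring in the same path are distinct, since (T2)
    excludes directed cycles, and hence adjacent, so that the contributions of
    disjoint 2-cells commute: this is a homomorphism from [D(K', w')] to the
    graph product. Conversely an element of [G_u] acts on the block [u] of any
    path [p u q] homotopic to [w]; by (T2) and (T3) the resulting element of
    [D(K', w')] does not depend on that path, and for adjacent vertices one can
    choose a common path, where the two actions commute. *)
From HB Require Import structures.
From mathcomp Require Import all_boot.
From mathcomp Require Import boolp.
From Stdlib Require List.
From Stdlib Require Import Relation_Operators.
Require Import Defs.

Set Implicit Arguments.
Unset Strict Implicit.
Unset Printing Implicit Defensive.

Local Open Scope group_scope.

(** * Squier edges as words *)

Section Raw.
Variable K : complex2.
Implicit Types (x y z p q : seq (edge K)) (f g : face K).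

(** The endpoints of 1-paths are dropped: since 2-cells have nonempty tops and
    bottoms, a word [x] determines all the Squier edges starting from it. *)
Definition redge : Type := seq (edge K) * face K * seq (edge K).
Implicit Types (e : redge) (s t : seq redge).

Definition rsrc e := e.1.1 ++ top e.1.2 ++ e.2.
Definition rtgt e := e.1.1 ++ bot e.1.2 ++ e.2.
Definition reinv e : redge := (e.1.1, finv e.1.2, e.2).
Definition rinv s := rev (map reinv s).
Definition whisk p q s : seq redge :=
  [seq (p ++ e.1.1, e.1.2, e.2 ++ q) | e <- s].

Fixpoint rwalk x s y : Prop :=
  if s is e :: s' then x = rsrc e /\ rwalk (rtgt e) s' y else x = y.

Definition reach x y := exists s, rwalk x s y.

Lemma rsrc_inv e : rsrc (reinv e) = rtgt e.
Proof. by rewrite /rsrc /= top_finv. Qed.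

Lemma rtgt_inv e : rtgt (reinv e) = rsrc e.
Proof. by rewrite /rtgt /= bot_finv. Qed.

Lemma rwalk_cat x y z s t : rwalk x s y -> rwalk y t z -> rwalk x (s ++ t) z.
Proof. by elim: s x => [x -> //|e s IH x /= [-> /IH h] /h]. Qed.

Lemma rwalk_inv x y s : rwalk x s y -> rwalk y (rinv s) x.
Proof.
elim: s x => [x -> //|e s IH x /= [-> /IH h]].
by rewrite /rinv /= rev_cons -cats1; apply: rwalk_cat h _;
  rewrite /= rsrc_inv rtgt_inv.
Qed.

Lemma rwalk_whisk p q x y s :
  rwalk x s y -> rwalk (p ++ x ++ q) (whisk p q s) (p ++ y ++ q).
Proof.
elim: s x => [x -> //|e s IH x /= [-> /IH h]].
by rewrite /rsrc /rtgt /= -!catA in h *.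
Qed.

Lemma reach_refl x : reach x x. Proof. by exists [::]. Qed.

Lemma reach_trans y x z : reach x y -> reach y z -> reach x z.
Proof. by move=> [s xs] [t yt]; exists (s ++ t); apply: rwalk_cat xs yt. Qed.

Lemma reach_sym x y : reach x y -> reach y x.
Proof. by case=> s /rwalk_inv h; exists (rinv s). Qed.

Lemma reach_edge e : reach (rsrc e) (rtgt e).
Proof. by exists [:: e]. Qed.

Lemma whisk_cat p q s t : whisk p q (s ++ t) = whisk p q s ++ whisk p q t.
Proof. exact: map_cat. Qed.

Lemma whisk_whisk p q p' q' s :
  whisk p q (whisk p' q' s) = whisk (p ++ p') (q' ++ q) s.
Proof.
by rewrite /whisk -map_comp; apply: eq_map => -[[a f] b] /=; rewrite !catA.
Qed.

Lemma whisk0 s : whisk [::] [::] s = s.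
Proof.
by rewrite /whisk -[RHS]map_id; apply: eq_map => -[[a f] b] /=; rewrite cats0.
Qed.

(** * Group-valued labellings of Squier edges and the groups they present *)

Section Labelling.
Variables (H : groupType) (mu : redge -> H).

(** These two conditions make the value of a walk invariant under homotopy: inverse edges cancel,
    and the attaching loop of every 2-cell of the Squier complex has value [1]. *)
Record labelling : Prop := Labelling {
  lab_inv : forall e, mu (reinv e) = (mu e)^-1;
  lab_cell : forall p f q g r,
    mu (p, f, q ++ top g ++ r) * mu (p ++ bot f ++ q, g, r) =
    mu (p ++ top f ++ q, g, r) * mu (p, f, q ++ bot g ++ r)
}.

Definition lval s : H := foldr (fun e h => mu e * h) 1 s.

Lemma lval_cat s t : lval (s ++ t) = lval s * lval t.
Proof. by elim: s => [|e s IH] /=; rewrite ?mul1g // IH mulgA. Qed.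

Lemma lval_inv (muP : labelling) s : lval (rinv s) = (lval s)^-1.
Proof.
elim: s => [|e s IH] /=; first by rewrite invg1.
by rewrite /rinv /= rev_cons -cats1 lval_cat IH /= mulg1 lab_inv // invgM.
Qed.

(** Walks acting on disjoint factors commute: the rectangle they span is tiled by Squier cells, and
    the induction on [s] and then on [t] peels off one cell at a time. *)
Lemma lval_interchange (muP : labelling) p z q x x' y y' s t :
  rwalk x s x' -> rwalk y t y' ->
  lval (whisk p (z ++ y ++ q) s) * lval (whisk (p ++ x' ++ z) q t) =
  lval (whisk (p ++ x ++ z) q t) * lval (whisk p (z ++ y' ++ q) s).
Proof.
move=> xs yt; elim: s x xs => [x -> |[[a f] b] s IH x /= [-> xs]].
  by rewrite /= mul1g mulg1.
rewrite -mulgA (IH _ xs) !mulgA; congr (_ * _) => {IH xs s}.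
rewrite /rsrc /rtgt /=; elim: t y yt => [y -> |[[c g] d] t IH y /= [-> yt]].
  by rewrite /= mul1g mulg1.
rewrite -[in RHS]mulgA -(IH _ yt) !mulgA; congr (_ * _).
have := lab_cell muP (p ++ a) f (b ++ z ++ c) g (d ++ q).
by rewrite /rsrc /rtgt /= -!catA.
Qed.

End Labelling.

(** [G], with generators the images of the Squier edges, is the group of loops at
    [w]; the universal property in [pres_inj] stands for the relation of
    homotopy, and quantifies over maps on all Squier edges, so that no base
    point is involved. *)
Record presentation (w : seq (edge K)) (G : groupType) (lam : redge ->
  G) : Prop :=
  Presentation {
  pres_lab : labelling lam;
  pres_surj : forall a, exists s, rwalk w s w /\ lval lam s = a;
  pres_inj : forall (H : groupType) (mu : redge -> H), labelling mu ->
    forall s, rwalk w s w -> lval lam s = 1 -> lval mu s = 1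
}.

(** An element is sent to the [mu]-value of a chosen loop representing it. Applying [pres_inj] to
    one loop followed by the inverse of another shows that the choice does not matter. *)
Lemma presentation_hom w (G : groupType) (lam : redge -> G) (H : groupType)
    (mu : redge -> H) : presentation w lam -> labelling mu ->
  exists phi : G -> H, {morph phi : a b / a * b} /\
    forall s, rwalk w s w -> phi (lval lam s) = lval mu s.
Proof.
case=> lamP surj inj muP.
have eqv s t : rwalk w s w -> rwalk w t w -> lval lam s = lval lam t ->
    lval mu s = lval mu t.
  move=> ws wt est; apply: (mulIg (lval mu t)^-1).
  rewrite mulgV -lval_inv // -lval_cat.
  apply: inj => //; first exact/(rwalk_cat ws)/rwalk_inv.
  by rewrite lval_cat lval_inv // est mulgV.
have [l lP] := choice surj.
exists (fun a => lval mu (l a)); split=> [a b|s ws]; last first.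
  by have [? ?] := lP (lval lam s); apply: eqv.
have [[wa ea] [[wb eb] [wab eab]]] := (lP a, (lP b, lP (a * b))).
rewrite -lval_cat; apply: eqv => //; first exact: rwalk_cat wa wb.
by rewrite lval_cat ea eb.
Qed.

Lemma presentation_isomorphic w (G G' : groupType) (lam : redge -> G)
    (lam' : redge -> G') :
  presentation w lam -> presentation w lam' -> isomorphic G G'.
Proof.
move=> P P'.
have [phi [phiM phiE]] := presentation_hom P (pres_lab P').
have [psi [psiM psiE]] := presentation_hom P' (pres_lab P).
exists phi; split=> //; exists psi => a.
  by have [s [ws <-]] := pres_surj P a; rewrite phiE ?psiE.
by have [s [ws <-]] := pres_surj P' a; rewrite psiE ?phiE.
Qed.

Lemma isomorphic_presentation w (G G' : groupType) (lam : redge -> G') :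
  isomorphic G G' -> presentation w lam -> exists lam' : redge ->
    G, presentation w lam'.
Proof.
move=> [f [fM [f' fK f'K]]] [[l1 l2] surj inj].
have f'M : {morph f' : a b / a * b}.
  by move=> a b; apply: (can_inj fK); rewrite f'K fM !f'K.
have f'1 : f' 1 = 1 by apply: (mulgI (f' 1)); rewrite -f'M !mulg1.
have f'V a : f' a^-1 = (f' a)^-1.
  by apply: (mulgI (f' a)); rewrite -f'M !mulgV.
have valE s : lval (f' \o lam) s = f' (lval lam s).
  by elim: s => [|e s IH] /=; rewrite ?f'1 // IH f'M.
exists (f' \o lam); split=> [|a|H mu muP s ws].
- by split=> [e|p g q h r] /=; rewrite ?l1 ?f'V // -!f'M l2.
- by have [s [ws es]] := surj (f a); exists s; rewrite valE es fK.
- by rewrite valE -f'1 => /(can_inj f'K); exact: inj.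
Qed.

(** [lam] is gauged so as to be trivial along the chosen paths [ga]. *)
Lemma presentation_spanning w (G : groupType) (lam0 : redge -> G) :
  presentation w lam0 -> exists (lam : redge -> G) (ga : seq (edge K) ->
    seq redge),
  [/\ ga w = [::], forall x, reach w x -> rwalk w (ga x) x,
      forall x, reach w x -> lval lam (ga x) = 1 & presentation w lam].
Proof.
move=> [[labV labC] surj inj].
have /choice[ga gaP] : forall x, exists s, (x = w -> s = [::]) /\
    (reach w x -> rwalk w s x).
  move=> x; have [->|xw] := pselect (x = w); first by exists [::].
  by have [[s ws]|n] := pselect (reach w x); [exists s | exists [::]].
have gaw : ga w = [::] by apply: (gaP w).1.
pose h x := lval lam0 (ga x).
(* The factors [h] telescope along a walk, so loops at [w], where [h] is [1], keep their values,
   while the path [ga x] gets value [1]. *)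
pose lam e := h (rsrc e) * lam0 e * (h (rtgt e))^-1.
have lamE x s y : rwalk x s y -> lval lam s = h x * lval lam0 s * (h y)^-1.
  elim: s x => [x /= ->|e s IH x /= [-> /IH ->]]; first by rewrite mulg1 mulgV.
  by rewrite /lam !mulgA mulgVK.
have lamw s : rwalk w s w -> lval lam s = lval lam0 s.
  by move=> /lamE ->; rewrite /h gaw /= mul1g invg1 mulg1.
exists lam, ga; split=> [//|x|x wx|]; first exact: (gaP x).2.
  by rewrite (lamE _ _ _ ((gaP x).2 wx)) /h gaw /= mul1g mulgV.
split=> [|a|H mu muP s ws]; last by rewrite lamw //; exact: inj.
- split=> [e|p f q g r].
    by rewrite /lam rsrc_inv rtgt_inv labV !invgM invgK mulgA.
  rewrite /lam /rsrc /rtgt /= -!catA !mulgA !mulgVK.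
  by congr (_ * _); rewrite -!mulgA labC.
- by have [s [ws <-]] := surj a; exists s; rewrite lamw.
Qed.

End Raw.

(** * Splitting directed walks *)

Lemma walk_split (D : digraph) (x z : vertex D) s t :
  walk x (s ++ t) z -> exists2 y, walk x s y & walk y t z.
Proof.
elim: s x => [|e s IH] x /=; first by exists x.
by case=> ex /IH [y sy yt]; exists y.
Qed.

Lemma walk_end_inj (D : digraph) (x y y' : vertex D) s :
  walk x s y -> walk x s y' -> y = y'.
Proof. by elim: s x => [x /= <- //|e s IH x /= [_ /IH h] [_ /h]]. Qed.

(** * Diagram groups are presented by labellings *)

Section PathLabelling.
Variables (X : cell_complex) (w : vertex X).
Implicit Types (x y : vertex X) (a b s t : seq (edge X)) (e : edge X).

Let rv s := rev (map (@einv X) s).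

Let rvK s : rv (rv s) = s.
Proof.
rewrite /rv map_rev revK -map_comp (eq_map (g := id)) ?map_id // => e /=.
exact: einvK.
Qed.

(** Made total, with default [1] off the loops at [w], so that classes can be computed on bare
    sequences. *)
Definition lclass s : pi1 w :=
  if pselect (walk w s w) is left h then @quot_class (pi1_pregroup w) (Loop h)
  else 1.

Lemma lclass_loop (l : loop w) : lclass l = @quot_class (pi1_pregroup w) l.
Proof.
rewrite /lclass; case: pselect => [h|/(_ (lwalk l))//].
by congr quot_class; apply: loop_ext.
Qed.

Lemma lclass_cat a b : walk w a w -> walk w b w ->
  lclass (a ++ b) = lclass a * lclass b.
Proof.
move=> wa wb; rewrite (lclass_loop (Loop wa)) (lclass_loop (Loop wb)).
rewrite (lclass_loop (loop_mul (Loop wa) (Loop wb))).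
exact/esym/(@quot_mulE (pi1_pregroup w)).
Qed.

Lemma lclass_cancel a s b : walk w (a ++ (s ++ rv s) ++ b) w ->
  lclass (a ++ (s ++ rv s) ++ b) = lclass (a ++ b).
Proof.
move=> h; have h' : walk w (a ++ b) w.
  have [x ax /walk_split [y xy yb]] := walk_split h.
  have [z xz zy] := walk_split xy.
  by apply: (walk_cat ax); rewrite (walk_end_inj (walk_rev xz) zy).
rewrite (lclass_loop (Loop h)) (lclass_loop (Loop h')).
by apply/quot_classP; apply: (@seq_cancel _ _ s a b).
Qed.

Lemma lclass_nil : lclass [::] = 1.
Proof. exact: (lclass_loop (loop_one w)). Qed.

Lemma lclass_cell a c b : walk w (a ++ b) w -> walk w (a ++ attach c ++ b) w ->
  lclass (a ++ attach c ++ b) = lclass (a ++ b).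
Proof.
move=> h h'; rewrite (lclass_loop (Loop h)) (lclass_loop (Loop h')).
by apply/quot_classP/rst_step; apply: (@loop_step_cell _ _ _ _ a b c).
Qed.

Definition lprod (G : groupType) (lam : edge X -> G) s : G :=
  foldr (fun e h => lam e * h) 1 s.

(** Chosen paths [ga] from [w] close each edge in the component of [w] to a loop, whose class is the
    label; all other edges get [1]. As [ga w] is empty, a loop at [w] is labelled by its own
    class. *)
Lemma pi1_labelling : exists lam : edge X -> pi1 w,
  [/\ forall e, lam (einv e) = (lam e)^-1,
      forall c, lprod lam (attach c) = 1 &
      forall l : loop w, lprod lam l = @quot_class (pi1_pregroup w) l].
Proof.
have [ga gaP] : exists ga : vertex X -> seq (edge X),
    ga w = [::] /\ forall x, (exists s, walk w s x) -> walk w (ga x) x.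
  have /choice[ga gaP] : forall x, exists s,
      (x = w -> s = [::]) /\ ((exists s, walk w s x) -> walk w s x).
    move=> x; have [->|xw] := pselect (x = w); first by exists [::].
    by have [[s ws]|n] := pselect (exists s, walk w s x);
      [exists s | exists [::]].
  by exists ga; split=> [|x]; [exact: (gaP w).1 | exact: (gaP x).2].
case: gaP => gaw gaP.
pose lam e : pi1 w := if pselect (exists s, walk w s (init e)) is left _ then
  lclass (ga (init e) ++ e :: rv (ga (term e))) else 1.
have reach1 e : (exists s, walk w s (init e)) -> exists s, walk w s (term e).
  by move=> [s h]; exists (s ++ [:: e]); apply: walk_cat h _.
have lamE x s y : (exists s', walk w s' x) -> walk x s y ->
    lprod lam s = lclass (ga x ++ s ++ rv (ga y)).
  elim: s x => [x wx /= <-|e s IH x wx /= [ex sy]]; first last.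
    subst x; have wx' := reach1 _ wx.
    rewrite (IH _ wx' sy) {1}/lam; case: pselect => // _.
    have [h h'] := (gaP _ wx, gaP _ wx').
    have wy : exists s, walk w s y.
      by exists (ga (term e) ++ s); apply: walk_cat h' sy.
    have hy := walk_rev (gaP _ wy).
    have h1 : walk w (ga (init e) ++ e :: rv (ga (term e))) w.
      by apply: (walk_cat h); split=> //; exact: walk_rev.
    have h2 : walk w (ga (term e) ++ s ++ rv (ga y)) w.
      exact/(walk_cat h')/(walk_cat sy).
    have := walk_cat h1 h2; rewrite -lclass_cat // -cat_rcons.
    (* Between [e] and the rest of the walk, the return along [ga (term e)] and the new departure
       along it cancel. *)
    have -> c : (rcons (ga (init e)) e ++ rv (ga (term e))) ++ ga (term e) ++
      c =
        rcons (ga (init e)) e ++ (rv (ga (term e)) ++ rv (rv (ga (term e)))) ++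
          c.
      by rewrite rvK -!catA.
    by move=> /lclass_cancel ->; rewrite cat_rcons.
  have := gaP _ wx => h; have := walk_cat h (walk_rev h).
  have := @lclass_cancel [::] (ga x) [::]; rewrite /= !cats0 => e /e.
  by rewrite lclass_nil => ->.
have lam0 x s y : ~ (exists s', walk w s' x) -> walk x s y -> lprod lam s = 1.
  elim: s x => [//|e s IH x nx /= [ex sy]]; subst x.
  rewrite {1}/lam; case: pselect => // _; rewrite mul1g; apply: IH sy.
  move=> [s' h]; apply: nx; exists (s' ++ [:: einv e]); apply: walk_cat h _.
  by rewrite /= init_einv term_einv.
exists lam; split=> [e|c|l].
- have we : walk (init e) [:: e; einv e] (init e).
    by rewrite /= init_einv term_einv.
  suff: lprod lam [:: e; einv e] = 1.
    by rewrite /= mulg1 => h; apply: (mulgI (lam e)); rewrite mulgV.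
  have [r|nr] := pselect (exists s, walk w s (init e)); last exact: lam0 we.
  have h := gaP _ r; rewrite (lamE _ _ _ r we).
  rewrite (@lclass_cancel (ga (init e)) [:: e]); last first.
    exact/(walk_cat h)/(walk_cat we)/walk_rev.
  have := walk_cat h (walk_rev h).
  have := @lclass_cancel [::] (ga (init e)) [::]; rewrite /= !cats0.
  by move=> e1 /e1; rewrite lclass_nil => ->.
- have wc := pwalk (attach c).
  have [r|nr] := pselect (exists s, walk w s (psrc (attach c)));
    last exact: lam0 wc.
  have h := gaP _ r; rewrite -attach_loop in wc; rewrite (lamE _ _ _ r wc).
  have h' := walk_cat h (walk_rev h); rewrite lclass_cell //; last first.
    exact/(walk_cat h)/(walk_cat wc)/walk_rev.
  have := @lclass_cancel [::] (ga (psrc (attach c))) [::]; rewrite /= !cats0.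
  by move=> e1; rewrite e1 // lclass_nil.
- have r : exists s, walk w s w by exists [::].
  by rewrite (lamE _ _ _ r (lwalk l)) gaw /= cats0 lclass_loop.
Qed.

End PathLabelling.

Lemma loop_step_lprod (X : cell_complex) (w : vertex X) (G : groupType)
    (lam : edge X -> G) :
  (forall e, lam (einv e) = (lam e)^-1) ->
  (forall c, lprod lam (attach c) = 1) ->
  forall l m : loop w, loop_eq l m -> lprod lam l = lprod lam m.
Proof.
move=> lamV lamc l m; have lprod_cat s t : lprod lam (s ++ t) = lprod lam s *
  lprod lam t.
  by elim: s => [|e s IH] /=; rewrite ?mul1g // IH mulgA.
elim=> [{}l {}m [a b e -> ->|a b c -> ->]|//|? ? _ ->|? ? ? _ -> _ ->] //.
  by rewrite !lprod_cat /= lamV mulVKg.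
by rewrite !lprod_cat lamc mul1g.
Qed.

(** * Passing between the Squier complex and words *)

Section Forget.
Variable K : complex2.
Implicit Types (E : sq_edge K) (P Q : nepath K).

Definition forget E : redge K := (pseq (sq_p E), sq_f E, pseq (sq_q E)).

Lemma forget_einv E : forget (sq_einv E) = reinv (forget E).
Proof. by []. Qed.

Lemma rsrc_forget E : rsrc (forget E) = pseq (sq_init E).
Proof. by rewrite /rsrc /= catA. Qed.

Lemma rtgt_forget E : rtgt (forget E) = pseq (sq_term E).
Proof. by rewrite /rtgt /= catA. Qed.

Lemma walk_forget P s Q : walk (D := squier K) P s Q ->
  rwalk (pseq P) (map forget s) (pseq Q).
Proof.
elim: s P => [P /= -> //|E s IH P /= [<- /IH]].
by rewrite rsrc_forget rtgt_forget.
Qed.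

Lemma walk_psrc P s Q : walk (D := squier K) P s Q ->
  psrc P = psrc Q /\ ptgt P = ptgt Q.
Proof. by elim: s P => [P /= -> //|E s IH P /= [<- /IH]]. Qed.

Lemma walk_sub_ends (t : path1 K) (x y : vertex K) :
  pseq t <> [::] -> walk x t y -> x = psrc t /\ y = ptgt t.
Proof.
case: t => [x' [//|e s] y' /= [<- sy']] _ [<- sy]; split=> //.
exact: walk_end_inj sy sy'.
Qed.

(** A nonempty [t] determines its endpoints, so the vertices at which the walk is cut must be those
    of [t]. *)
Lemma walk_factor (p q : seq (edge K)) (t : path1 K) (x y : vertex K) :
  pseq t <> [::] -> walk x (p ++ t ++ q) y ->
  exists P Q : path1 K, [/\ pseq P = p, pseq Q = q, psrc P = x, ptgt Q = y
    & ptgt P = psrc t /\ ptgt t = psrc Q].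
Proof.
move=> t0 /walk_split [m xm /walk_split [n mn ny]].
have [em en] := walk_sub_ends t0 mn; subst m n.
by exists (Path1 xm), (Path1 ny).
Qed.

Definition lifts (w : nepath K) (e : redge K) E :=
  [/\ forget E = e, psrc (sq_p E) = psrc w & ptgt (sq_q E) = ptgt w].

Lemma lift_exists (w : nepath K) (e : redge K) :
  walk (psrc w) (rsrc e) (ptgt w) -> exists E, lifts w e E.
Proof.
case: e => [[p f] q] /(walk_factor (@top_neq0 K f)) [P [Q [pp qq wp wq [pf
  fq]]]].
by exists (SqEdge pf fq); rewrite /lifts /forget /= pp qq.
Qed.

Lemma lift_unique (w : nepath K) (e : redge K) E E' :
  lifts w e E -> lifts w e E' -> E = E'.
Proof.
move=> [<- s1 t1] [[ep ef eq] s2 t2]; apply: sq_edge_eq => //;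
  apply: path1_eq => //.
- by rewrite s1.
- by rewrite sq_pf (sq_pf E') ef.
- by rewrite -sq_fq -(sq_fq E') ef.
- by rewrite t1.
Qed.

Lemma lift_src (w : nepath K) (e : redge K) E : lifts w e E ->
  walk (psrc w) (rsrc e) (ptgt w).
Proof. by case=> <- <- <-; rewrite rsrc_forget; exact: pwalk (sq_init E). Qed.

Lemma lift_walk P s y : rwalk (pseq P) s y -> exists Q s',
  [/\ walk (D := squier K) P s' Q, map forget s' = s & pseq Q = y].
Proof.
elim: s P => [P /= <-|e s IH P /= [eP ey]]; first by exists P, [::].
have /lift_exists [E [eE sE tE]] : walk (psrc P) (rsrc e) (ptgt P).
  by rewrite -eP; exact: pwalk.
have iE : sq_init E = P.
  by apply/nepath_eq/path1_eq => //; rewrite eP -eE rsrc_forget.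
have := ey; rewrite -eE rtgt_forget => /IH [Q [s' [ws es eQ]]].
by exists Q, (E :: s'); rewrite /= es eE.
Qed.

Lemma walk_top_bot (p q : seq (edge K)) (f : face K) (x y : vertex K) :
  walk x (p ++ top f ++ q) y <-> walk x (p ++ bot f ++ q) y.
Proof.
have imp (t t' : path1 K) : psrc t = psrc t' -> ptgt t = ptgt t' ->
    pseq t <> [::] -> walk x (p ++ t ++ q) y -> walk x (p ++ t' ++ q) y.
  move=> es et t0 h; have [P [Q [<- <- <- <- [pf fq]]]] := walk_factor t0 h.
  apply: walk_cat (pwalk P) _; rewrite pf es; apply: walk_cat (pwalk t') _.
  by rewrite -et fq; exact: pwalk.
by split; apply: imp; rewrite ?bot_src ?bot_tgt //;
  [exact: top_neq0 | exact: bot_neq0].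
Qed.

(** An edge on words is labelled through its unique lift between paths parallel to [w], and by [1]
    if its source is not such a path. By [walk_top_bot], the four edges of a cell all lift or all
    fail to lift. *)
Lemma diagram_group_presentation (w : nepath K) :
  exists lam : redge K -> diagram_group w, presentation (pseq w) lam.
Proof.
have [la [laV lac lal]] := @pi1_labelling (squier K) w.
pose lam e : diagram_group w :=
  if pselect (exists E, lifts w e E) is left h then la (projT1 (cid h)) else 1.
have lamE e E : lifts w e E -> lam e = la E.
  move=> h; rewrite /lam; case: pselect => [h'|[]]; last by exists E.
  by congr la; apply: lift_unique (projT2 (cid h')) h.
have lam0 e : ~ walk (psrc w) (rsrc e) (ptgt w) -> lam e = 1.
  by move=> n; rewrite /lam; case: pselect => // h; case: n; case: h =>
    E /lift_src.
have lamP : labelling lam.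
  split=> [e|p f q g r].
    have [h|n] := pselect (walk (psrc w) (rsrc e) (ptgt w)); last first.
      rewrite !lam0 ?invg1 // rsrc_inv => h; apply: n.
      by case: e h => [[p f] q]; rewrite /rsrc /rtgt /= => /walk_top_bot.
    have [E [eE sE tE]] := lift_exists h.
    rewrite (lamE e E) // (lamE _ (sq_einv E)); first exact: (laV E).
    by split=> //; rewrite -eE.
  have n4 : walk (psrc w) (p ++ top f ++ q ++ top g ++ r) (ptgt w) <->
      walk (psrc w) ((p ++ top f ++ q) ++ top g ++ r) (ptgt w).
    by rewrite -!catA.
  have n2 : walk (psrc w) (p ++ top f ++ q ++ top g ++ r) (ptgt w) <->
      walk (psrc w) ((p ++ bot f ++ q) ++ top g ++ r) (ptgt w).
    by rewrite walk_top_bot -!catA.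
  have n3 : walk (psrc w) (p ++ top f ++ q ++ top g ++ r) (ptgt w) <->
      walk (psrc w) (p ++ top f ++ q ++ bot g ++ r) (ptgt w).
    by rewrite n4 walk_top_bot -!catA.
  have [h|n] := pselect (walk (psrc w) (p ++ top f ++ q ++ top g ++
    r) (ptgt w));
    last by rewrite !lam0 // /rsrc /= -?n2 -?n3 -?n4.
  have [P [QR [<- eqr wp wr [pf fqr]]]] := walk_factor (@top_neq0 K f) h.
  have := pwalk QR; rewrite eqr.
  move=> /(walk_factor (@top_neq0 K g)) [Q [R [<- <- wq wr' [qg gr]]]].
  have fq : ptgt (top f) = psrc Q by rewrite fqr wq.
  pose c := SqCell pf fq qg gr.
  have := lac c; rewrite /= !(laV (sq_e3 _)) !(laV (sq_e4 _)) mulg1 => hc.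
  rewrite (lamE _ (sq_e1 c)); last by split; rewrite /= ?wr' // /forget /= catA.
  rewrite (lamE _ (sq_e2 c)); last by split; rewrite /= ?wr' // /forget /= catA.
  rewrite (lamE _ (sq_e4 c)); last by split; rewrite /= ?wr' // /forget /= catA.
  rewrite (lamE _ (sq_e3 c)); last by split; rewrite /= ?wr' // /forget /= catA.
  apply: (mulIg (la (sq_e3 c))^-1); apply: (mulIg (la (sq_e4 c))^-1).
  by rewrite -!mulgA hc mulVKg mulgV.
have lamF s : forall P Q, walk (D := squier K) P s Q -> psrc P = psrc w ->
    ptgt P = ptgt w -> lval lam (map forget s) = lprod la s.
  elim: s => [//|E s IH] P Q /= [eP sQ] sP tP; rewrite (IH _ _ sQ).
  - by rewrite (lamE _ E) //; split=> //; rewrite -?sP -?tP -eP.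
  - by rewrite -sP -eP.
  - by rewrite -tP -eP.
exists lam; split=> // [a|H mu muP s /lift_walk [Q [s' [ws' es eQ]]]].
  elim/quot_ind: a => l; exists (map forget l).
  split; first exact/walk_forget/lwalk.
  by rewrite (lamF _ _ _ (lwalk l)) // lal.
have [sQ tQ] := walk_psrc ws'.
have eQw : Q = w by apply/nepath_eq/path1_eq.
rewrite eQw in ws'; rewrite -es (lamF _ _ _ ws') //.
rewrite (lal (Loop ws')) => /quot_classP.
(* A trivial class means that the lifted loop is homotopic to the empty one, and [mu \o forget] is a
   homotopy invariant. *)
have valE t : lval mu (map forget t) = lprod (X := squier K) (mu \o forget) t.
  by elim: t => //= E t ->.
move=> /loop_step_lprod h; rewrite valE.
rewrite (h _ (mu \o forget)) // => [E|c]; first exact: (lab_inv muP (forget E)).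
rewrite /= mulg1 !forget_einv !(lab_inv muP) mulgA.
have := lab_cell muP (pseq (sc_p c)) (sc_f c) (pseq (sc_q c)) (sc_g c) (pseq
  (sc_r c)).
rewrite /forget /= -!catA => ->.
by rewrite -mulgA mulVKg mulgV.
Qed.

End Forget.

(** * Rooted 2-trees and graph products *)

Section RootedTree.
Variables (K : complex2) (w : nepath K).

Lemma homotopic_reach (p q : path1 K) : homotopic p q ->
  reach (pseq p) (pseq q).
Proof.
move=> [->|[P [Q [s [<- <- /walk_forget h]]]]]; first exact: reach_refl.
by exists (map (@forget K) s).
Qed.

Lemma reach_homotopic x : reach (pseq w) x ->
  exists p : path1 K, [/\ pseq p = x, psrc p = psrc w, ptgt p = ptgt w &
    homotopic p w].
Proof.
move=> [s /lift_walk [Q [s' [ws _ eQ]]]].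
have [eqs eqt] := walk_psrc ws; exists Q; split=> //; right.
exists Q, w, (rev (map (@einv (squier K)) s')); split=> //.
exact: walk_rev ws.
Qed.

Lemma homotopic_root p : homotopic p w -> reach (pseq w) (pseq p).
Proof. by move=> h; apply/reach_sym/homotopic_reach. Qed.

Lemma in_split_cat (T : Type) (e : T) s : List.In e s ->
  exists p q, s = p ++ e :: q.
Proof. by move=> h; have [p [q ->]] := @List.in_split T e s h; exists p, q. Qed.

Lemma reach_walk x : reach (pseq w) x -> walk (psrc w) x (ptgt w).
Proof. by move=> /reach_homotopic [p [<- <- <- _]]; exact: pwalk. Qed.

Lemma indep_vert_reach (u : indep_vert w) :
  exists p q, reach (pseq w) (p ++ sval u :: q).
Proof.
case: u => e h /=; have [p [pw ein]] := h; have [a [b ab]] := in_split_cat ein.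
exists a, b.
by rewrite -ab; exact: homotopic_root.
Qed.

Hypothesis tree : rooted_2tree w.

Lemma tree_path x : walk (psrc w) x (ptgt w) -> reach (pseq w) x.
Proof.
by move=> h; apply: (homotopic_root (p := Path1 h)); apply: (rt_T2 tree).
Qed.

Lemma pverts_split (p : path1 K) o : List.In o (pverts p) ->
  exists s t, walk (psrc p) s o /\ walk o t (ptgt p).
Proof.
case: p => x s y h; rewrite /pverts /= => ho.
elim: s x h ho => [|e s IH] x /=.
  by move=> <- [<-|//]; exists [::], [::].
case=> ex h [<-|/(IH _ h) [s' [t' [h1 h2]]]]; first by exists [::], (e :: s).
by exists (e :: s'), t'.
Qed.

(** By (T1) there are walks from the source of [w] to [init e] and from [term e] to the target of
    [w]. Joined by [e] they are parallel to [w], hence homotopic to it by (T2). *)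
Lemma tree_edge (e : edge K) : exists p : path1 K, homotopic p w /\ List.In e p.
Proof.
have [p [sp tp /pverts_split [s [_ [hs _]]]]] := rt_T1 tree (init e).
have [q [sq tq /pverts_split [_ [t [_ ht]]]]] := rt_T1 tree (term e).
rewrite sp in hs; rewrite tq in ht.
have h : walk (psrc w) (s ++ e :: t) (ptgt w) by apply: walk_cat hs _.
have [r [er _ _ rw]] := reach_homotopic (tree_path h).
exists r; split=> //; rewrite er; apply: List.in_or_app; right;
  exact: List.in_eq.
Qed.

(** The two prefixes are parallel, both ending at [init e], and so are the two suffixes; (T2)
    applies to each pair. *)
Lemma tree_factor p q p' q' (e : edge K) : reach (pseq w) (p ++ e :: q) ->
  reach (pseq w) (p' ++ e :: q') -> reach p p' /\ reach q q'.
Proof.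
move=> /reach_walk /walk_split [x hp /= [ex hq]].
move=> /reach_walk /walk_split [x' hp' /= [ex' hq']]; subst x x'.
by split; [apply: (homotopic_reach (p := Path1 hp) (q := Path1 hp')) |
  apply: (homotopic_reach (p := Path1 hq) (q := Path1 hq'))];
    apply: (rt_T2 tree).
Qed.

(** A repetition yields the directed cycle [e :: q], which (T2) would make homotopic to an empty
    path; but an empty path is homotopic only to itself. *)
Lemma tree_nodup p q r (e : edge K) : ~ reach (pseq w) (p ++ e :: q ++ e :: r).
Proof.
move=> /reach_walk /walk_split [x _ /= [ex /walk_split [y hq [ey _]]]];
  subst x y.
have h : walk (init e) (e :: q) (init e) by [].
pose P0 := @Path1 K (init e) [::] (init e) erefl.
have [/(congr1 (@pseq K)) //|] : homotopic (Path1 h) P0 by apply: (rt_T2 tree).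
by case=> P [Q [s [_ eQ _]]]; have := @np_neq0 K Q; rewrite eQ.
Qed.

(** By (T3) the loop is trivial in the presented group, and [pres_inj] carries this to every
    labelling. *)
Lemma tree_loop (H : groupType) (mu : redge K -> H) s : labelling mu ->
  rwalk (pseq w) s (pseq w) -> lval mu s = 1.
Proof.
have [lam P] := diagram_group_presentation w.
by move=> muP ws; apply: (pres_inj P muP ws); exact: (rt_T3 tree).
Qed.

Lemma tree_adj (u u' : indep_vert w) p q r :
  reach (pseq w) (p ++ sval u :: q ++ sval u' :: r) -> indep_adj u u'.
Proof.
move=> h; split=> [eu|]; first
  by apply: (tree_nodup (p := p) (q := q) (r := r)); rewrite -eu in h; exact: h.
have [t [et _ _ tw]] := reach_homotopic h.
by exists t; split=> //; rewrite et ?List.in_app_iff /= ?List.in_app_iff /=;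
  tauto.
Qed.

Lemma adj_reach (u u' : indep_vert w) : indep_adj u u' -> exists p q r,
  reach (pseq w) (p ++ sval u :: q ++ sval u' :: r) \/
  reach (pseq w) (p ++ sval u' :: q ++ sval u :: r).
Proof.
case=> ne [t [/homotopic_root h ut u't]].
have [p [q e]] := in_split_cat ut; move: u't; rewrite e in h *.
rewrite List.in_app_iff /= => -[|[//|]] h'; have [a [b ab]] := in_split_cat h'.
  by exists a, b, q; right; rewrite ab -catA in h.
by exists p, a, b; left; rewrite ab in h.
Qed.

End RootedTree.

(** * Generators and universal property of the graph product *)

Section GraphProduct.
Variables (Gam : graph) (G : vert Gam -> groupType).

Definition gp_in u (g : G u) : graph_product G :=
  @quot_class (nc_pregroup (@graph_commutator Gam G)) (fp_in g).

Lemma quot_class_mul (P : pregroup) (x y : P) :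
  @quot_class P (pg_mul x y) = (@quot_class P x : quot_group P) *
    @quot_class P y.
Proof. exact/esym/quot_mulE. Qed.

Lemma fp_inM u : {morph @fp_in _ G u : g h / g * h}.
Proof.
move=> g h; rewrite -quot_class_mul; apply/quot_classP/rst_sym/rst_step.
exact: (fp_stepM [::] [::]).
Qed.

Lemma gp_inM u : {morph @gp_in u : g h / g * h}.
Proof.
by move=> g h; rewrite /gp_in fp_inM (quot_class_mul (P := nc_pregroup _)).
Qed.

Lemma gp_in_comm u u' (g : G u) (h : G u') : adj u u' ->
  gp_in g * gp_in h = gp_in h * gp_in g.
Proof.
move=> uu'; rewrite -!(quot_class_mul (P := nc_pregroup _)); apply/quot_classP.
rewrite /= /nc_eq; apply/nc_eq_sym/nc_gen.
suff -> : (fp_in h * fp_in g)^-1 * (fp_in g * fp_in h) = [~ fp_in g, fp_in h].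
  exact: GraphCommutator.
by rewrite /commg /conjg invgM !mulgA.
Qed.

Lemma gp_ind (Q : graph_product G -> Prop) : Q 1 ->
  (forall a b, Q a -> Q b -> Q (a * b)) -> (forall u (g : G u), Q (gp_in g)) ->
  forall a, Q a.
Proof.
move=> Q1 QM Qin; elim/quot_ind; elim/quot_ind; elim=> [//|[u g] s IH].
have -> : @quot_class (fp_pregroup G) (existT _ u g :: s) =
    (fp_in g : free_product G) * @quot_class (fp_pregroup G) s.
  by rewrite -quot_class_mul.
by rewrite (quot_class_mul (P := nc_pregroup _)); apply: QM (Qin _ _) IH.
Qed.

(** The family extends to words as [F0], descends to the free product as [F1] because it respects
    both reductions, and to the graph product as [F2] because it kills the commutators. *)
Lemma gp_hom (H : groupType) (phi : forall u, G u -> H) :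
  (forall u, {morph phi u : g h / g * h}) ->
  (forall u u' (g : G u) (h : G u'), adj u u' ->
     phi u g * phi u' h = phi u' h * phi u g) ->
  exists Phi : graph_product G -> H,
    {morph Phi : a b / a * b} /\ forall u (g : G u), Phi (gp_in g) = phi u g.
Proof.
move=> phiM phiC.
have phi1 u : phi u 1 = 1 by apply: (mulgI (phi u 1)); rewrite -phiM !mulg1.
pose F0 (s : seq (letter G)) : H := foldr (fun x h => phi _ (projT2 x) * h) 1 s.
have F0_cat s t : F0 (s ++ t) = F0 s * F0 t.
  by elim: s => [|x s IH] /=; rewrite ?mul1g // IH mulgA.
have F0_eq s t : fp_eq s t -> F0 s = F0 t.
  elim=> [? ? [a b v|a b v g h]|//|? ? _ -> //|? ? ? _ -> _ ->] //;
    rewrite !F0_cat /=; first by rewrite phi1 mul1g.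
  by rewrite phiM -!mulgA.
pose F1 (c : free_product G) : H := F0 (@quot_repr (fp_pregroup G) c).
have F1E s : F1 (@quot_class (fp_pregroup G) s) = F0 s.
  by apply: F0_eq; exact: (@quot_repr_class (fp_pregroup G)).
have F1M : {morph F1 : a b / a * b}.
  elim/quot_ind=> s; elim/quot_ind=> t.
  by rewrite -(quot_class_mul (P := fp_pregroup G)) !F1E -F0_cat.
have F1_1 : F1 1 = 1 by apply: (mulgI (F1 1)); rewrite -F1M !mulg1.
have F1V a : F1 a^-1 = (F1 a)^-1 by apply: (mulgI (F1 a)); rewrite -F1M !mulgV.
have F1in u (g : G u) : F1 (fp_in g) = phi u g by rewrite F1E /= mulg1.
have F1nc a : normal_closure (@graph_commutator Gam G) a -> F1 a = 1.
  elim=> [_ [s t g h st]||x y _ hx _ hy|x _ hx|x y _ hx] //.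
  - rewrite /commg /conjg !F1M !F1V !F1in.
    by rewrite (phiC _ _ _ _ st) mulKg mulVg.
  - by rewrite F1M hx hy mulg1.
  - by rewrite F1V hx invg1.
  - by rewrite /conjg !F1M hx mul1g F1V mulVg.
have F1_eq a b : nc_eq (@graph_commutator Gam G) a b -> F1 a = F1 b.
  move=> /F1nc; rewrite F1M F1V => h; apply: (mulgI (F1 a)^-1).
  by rewrite h mulVg.
pose F2 (c : graph_product G) : H :=
  F1 (@quot_repr (nc_pregroup (@graph_commutator Gam G)) c).
have F2E a : F2 (@quot_class (nc_pregroup (@graph_commutator Gam G)) a) = F1 a.
  by apply: F1_eq; exact: (@quot_repr_class (nc_pregroup _)).
exists F2; split=> [|u g]; last by rewrite F2E F1in.
elim/quot_ind=> a; elim/quot_ind=> b.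
by rewrite -(quot_class_mul (P := nc_pregroup _)) !F2E F1M.
Qed.

End GraphProduct.

(** * The expanded complex *)

Section OneVertexComplex.
Variables (A F : Type) (ft fb : F -> seq A) (fi : F -> F).
Hypotheses (ft0 : forall f, ft f <> [::]) (fb0 : forall f, fb f <> [::]).
Hypotheses (fiK : involutive fi) (fi_neq : forall f, fi f <> f).
Hypothesis ft_inv : forall f, ft (fi f) = fb f.
Hypothesis fb_inv : forall f, fb (fi f) = ft f.

Definition one_vertex_graph : digraph := @Digraph unit A (fun=> tt) (fun=> tt).

Lemma one_vertex_walk (s : seq A) : walk (D := one_vertex_graph) tt s tt.
Proof. by elim: s. Qed.

Definition one_vertex_path (s : seq A) : path1 one_vertex_graph :=
  Path1 (one_vertex_walk s).

(** With one vertex every word is a 1-path: this is the complex of the semigroup presentation with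
    generators [A] and relations [ft f = fb f]. *)
Definition one_vertex_complex : complex2 :=
  @Complex2 one_vertex_graph F (one_vertex_path \o ft) (one_vertex_path \o fb)
    ft0 fb0 (fun=> erefl) (fun=> erefl) fi fiK fi_neq
    (fun f => congr1 one_vertex_path (ft_inv f))
    (fun f => congr1 one_vertex_path (fb_inv f)).

End OneVertexComplex.

Lemma dep_choice (I : Type) (T : I -> Type) (Q : forall i, T i -> Prop) :
  (forall i, exists x, Q i x) -> exists f : forall i, T i, forall i, Q i (f i).
Proof.
by move=> h; exists (fun i => projT1 (cid (h i))) => i;
  exact: projT2 (cid (h i)).
Qed.

Lemma catI (T : Type) (a b c : seq T) : a ++ b = a ++ c -> b = c.
Proof. by elim: a => //= x a IH [/IH]. Qed.

Lemma cat_eq_cat (T : Type) (a b c d : seq T) : a ++ b = c ++ d ->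
  exists k, (a = c ++ k /\ d = k ++ b) \/ (c = a ++ k /\ b = k ++ d).
Proof. exact: List.app_eq_app. Qed.

Lemma map_cat_inv (T S : Type) (f : T -> S) s a b : map f s = a ++ b ->
  exists s1 s2, [/\ s = s1 ++ s2, map f s1 = a & map f s2 = b].
Proof. by move=> /List.map_eq_app [s1 [s2 [-> [<- <-]]]]; exists s1, s2. Qed.

(** * Words of bracketed blocks, their expansion and contraction *)

Section Blocks.
Variables (K : complex2) (w : seq (edge K)) (V : Type).
Variables (sv : V -> edge K) (v : edge K -> V).
Hypotheses (vK : cancel v sv) (svK : cancel sv v).
Variables (L : V -> complex2) (wL : forall u, seq (edge (L u))).

(** An edge of [L u], or an opening ([true]) or closing ([false]) bracket of [u].
    Both brackets are needed: without the closing one, [w_u] could be a proper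
    prefix of the content of a block, and 2-cells of [K] would apply there. *)
Definition block_letter : Type := {u : V & (edge (L u) + bool)%type}.
Definition inner u (x : edge (L u)) : block_letter :=
  existT (fun u => (edge (L u) + bool)%type) u (inl x).
Definition opening u : block_letter :=
  existT (fun u => (edge (L u) + bool)%type) u (inr true).
Definition closing u : block_letter :=
  existT (fun u => (edge (L u) + bool)%type) u (inr false).
Definition inners u (x : seq (edge (L u))) : seq block_letter :=
  map (@inner u) x.

Definition block : Type := {u : V & seq (edge (L u))}.
Definition Block u (x : seq (edge (L u))) : block :=
  existT (fun u => seq (edge (L u))) u x.
Definition block_word (b : block) : seq block_letter :=
  opening (projT1 b) :: inners (projT2 b) ++ [:: closing (projT1 b)].
Fixpoint unblock (B : seq block) : seq block_letter :=
  if B is b :: B' then block_word b ++ unblock B' else [::].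
Definition root_blocks (z : seq (edge K)) : seq block :=
  [seq Block (wL (v e)) | e <- z].
Definition expand (z : seq (edge K)) : seq block_letter :=
  unblock (root_blocks z).
Definition contract (B : seq block) : seq (edge K) :=
  [seq sv (projT1 b) | b <- B].

Lemma inners_cat u (x y : seq (edge (L u))) :
  inners (x ++ y) = inners x ++ inners y.
Proof. exact: map_cat. Qed.

Lemma unblock_cat B B' : unblock (B ++ B') = unblock B ++ unblock B'.
Proof. by elim: B => //= b B ->; rewrite catA. Qed.

Lemma root_blocks_cat z z' :
  root_blocks (z ++ z') = root_blocks z ++ root_blocks z'.
Proof. exact: map_cat. Qed.

Lemma expand_cat z z' : expand (z ++ z') = expand z ++ expand z'.
Proof. by rewrite /expand root_blocks_cat unblock_cat. Qed.

Lemma contract_cat B B' : contract (B ++ B') = contract B ++ contract B'.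
Proof. exact: map_cat. Qed.

Lemma contract_root_blocks z : contract (root_blocks z) = z.
Proof.
by rewrite /contract /root_blocks -map_comp; elim: z => //= e z ->; rewrite vK.
Qed.

Lemma root_blocks_sv u z :
  root_blocks (sv u :: z) = Block (wL u) :: root_blocks z.
Proof. by rewrite /root_blocks /= svK. Qed.

Lemma expand_sv u z :
  expand (sv u :: z) = block_word (Block (wL u)) ++ expand z.
Proof. by rewrite /expand root_blocks_sv. Qed.

(** * Parsing bracketed words *)

Definition as_inner u (a : block_letter) : option (edge (L u)) :=
  if pselect (projT1 a = u) is left e then
    if eq_rect _ (fun u => (edge (L u) + bool)%type) (projT2 a) u e is inl x
    then Some x else None
  else None.

Lemma as_inner_inl u (x : edge (L u)) : as_inner u (inner x) = Some x.
Proof.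
by rewrite /as_inner; case: pselect => [e|//];
  rewrite (Prop_irrelevance e erefl).
Qed.

Lemma as_inner_inr u u' b :
  as_inner u (existT (fun u => (edge (L u) + bool)%type) u' (inr b)) = None.
Proof. by rewrite /as_inner /=; case: pselect => // e; case: u / e. Qed.

Lemma as_inner_opening u u' : as_inner u (opening u') = None.
Proof. exact: as_inner_inr. Qed.
Lemma as_inner_closing u u' : as_inner u (closing u') = None.
Proof. exact: as_inner_inr. Qed.

(** Recovers from the surrounding word the part of a block next to a 2-cell of [L u]; any bracket
    ends the run. *)
Fixpoint inner_prefix u (s : seq block_letter) : seq (edge (L u)) :=
  if s is a :: s' then
    if as_inner u a is Some x then x :: inner_prefix u s' else [::]
  else [::].
Definition inner_suffix u s := rev (inner_prefix u (rev s)).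

Lemma inner_prefix_inners u (x : seq (edge (L u))) s :
  inner_prefix u (inners x ++ s) = x ++ inner_prefix u s.
Proof. by elim: x => //= a x IH; rewrite as_inner_inl IH. Qed.

Lemma inner_prefix_stop u a q r : as_inner u a = None ->
  inner_prefix u (q ++ a :: r) = inner_prefix u q.
Proof.
by move=> ha; elim: q => [|b q IH] /=;
  [rewrite ha | case: as_inner => // x; rewrite IH].
Qed.

Lemma inner_suffix_inners u (x : seq (edge (L u))) s :
  inner_suffix u (s ++ inners x) = inner_suffix u s ++ x.
Proof.
by rewrite /inner_suffix rev_cat /inners -map_rev inner_prefix_inners rev_cat
  revK.
Qed.

Lemma inner_suffix_stop u a q r : as_inner u a = None ->
  inner_suffix u (r ++ a :: q) = inner_suffix u q.
Proof.
by move=> ha; rewrite /inner_suffix rev_cat rev_cons cat_rcons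
  inner_prefix_stop.
Qed.

Lemma inner_prefix_closing u (x : seq (edge (L u))) s :
  inner_prefix u (inners x ++ closing u :: s) = x.
Proof. by rewrite inner_prefix_inners /= as_inner_closing cats0. Qed.

Lemma inner_suffix_opening u (x : seq (edge (L u))) s :
  inner_suffix u (s ++ opening u :: inners x) = x.
Proof.
by rewrite -cat_rcons inner_suffix_inners /inner_suffix rev_rcons /=
  as_inner_opening.
Qed.

(** Comparing first letters gives [u = u'], and [z], which has no brackets, must stop before the
    closing one. The equality is between blocks because [x] and [z] have different types until the
    indices are identified. *)
Lemma inners_prefix u u' (x : seq (edge (L u))) (z : seq (edge (L u'))) s q :
  z <> [::] -> inners x ++ closing u :: s = inners z ++ q ->
  exists y, Block x = Block (z ++ y) /\ q = inners y ++ closing u' :: s.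
Proof.
case: z x => [//|c z] [|c0 x] _ e.
  by have := congr1 (inner_prefix u') e;
    rewrite inner_prefix_inners /= as_inner_closing.
have e' : u = u'.
  by have := congr1 (fun s => if s is a :: _ then projT1 a else u) e.
case: u' / e' c z e => c z e; exists (inner_prefix u q).
have ex : c0 :: x = (c :: z) ++ inner_prefix u q.
  by rewrite -[LHS](inner_prefix_closing _ s) [inners _ ++
    _]e inner_prefix_inners.
split; first by rewrite -ex.
by apply: (@catI _ (inners (c :: z))); rewrite -e ex inners_cat -catA.
Qed.

(** An occurrence of [z] contains no bracket, so it cannot cross a block boundary. In the induction
    it starts in the content of the first block, at its closing bracket, which is absurd, or in a
    later block. *)
Lemma unblock_inners_split B u (z : seq (edge (L u))) p q : z <> [::] ->
  unblock B = p ++ inners z ++ q ->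
  exists B1 x y B2, [/\ B = B1 ++ Block (x ++ z ++ y) :: B2,
    p = unblock B1 ++ opening u :: inners x &
      q = inners y ++ closing u :: unblock B2].
Proof.
move=> z0; elim: B p => [|[u0 x0] B IH] p.
  by case: p => //=; case: z z0.
case: p => [|a p] /=; first by case: z z0 IH => // c z _ _ [].
case=> <-; rewrite -catA => /cat_eq_cat [k [[ex es]|[ep es]]].
  have [x1 [x2 [e1 e2 e3]]] := map_cat_inv ex.
  have es' : inners x2 ++ closing u0 :: unblock B = inners z ++ q
    by rewrite es -e3.
  have [y [/= e4 e5]] := inners_prefix z0 es'.
  have e6 : u0 = u by case: e4.
  move: z z0 es es' y e4 e5 IH; rewrite -e6 => z z0 es es' y e4 e5 IH.
  have ex2 : x2 = z ++ y.
    by rewrite -[LHS](inner_prefix_closing x2 (unblock B)) es' e5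
      inner_prefix_inners inner_prefix_closing.
  exists [::], x1, y, B; split; rewrite ?e1 ?ex2 //.
  by rewrite -e2.
case: k ep es => [|a' k] ep /= es.
  have es' : inners (u := u0) [::] ++ closing u0 :: unblock B = inners z ++ q
    by rewrite es.
  have [y [/= e4 _]] := inners_prefix z0 es'.
  by have := congr1 (fun b : block => size (projT2 b)) e4; case: (z) z0.
case: es => ea /IH [B1 [x [y [B2 [-> ek ->]]]]].
exists (Block x0 :: B1), x, y, B2; split=> //.
by rewrite ep -ea ek /= -!catA.
Qed.

Definition is_opening (a : block_letter) : bool :=
  if projT2 a is inr true then true else false.

Lemma unblock_opening_split B u p r : unblock B = p ++ opening u :: r ->
  exists B1 B2, [/\ B = B1 ++ B2, p = unblock B1 & unblock B2 = opening u :: r].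
Proof.
elim: B p => [|b B IH] p; first by case: p.
case: p => [|a p] /=; first by move=> e; exists [::], (b :: B).
case=> <- /cat_eq_cat [k [[ex es]|[-> es]]]; last first.
  have [B1 [B2 [-> -> e]]] := IH _ es.
  by exists (b :: B1), B2.
case: k ex es => [|a' k] ex /= es.
  by exists [:: b], B; rewrite /= cats0 -es /block_word ex cats0.
case: es => ea _; rewrite -ea in ex.
have : all (predC is_opening) (inners (projT2 b) ++ [:: closing (projT1 b)]).
  by rewrite all_cat /= andbT; apply/(all_nthP (opening u)) => i;
    elim: (projT2 b) i => //= c x IHx [|i] //; exact: IHx.
by rewrite ex all_cat /= andbF.
Qed.

(** The closing brackets on both sides force each content to be exactly [wL], not merely to begin
    with it. *)
Lemma unblock_expand_prefix B z q : unblock B = expand z ++ q ->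
  exists B', B = root_blocks z ++ B' /\ q = unblock B'.
Proof.
elim: z B => [|e z IH] B; first by exists B.
case: B => [//|[u x] B]; rewrite /expand /= -!catA => -[eu].
move: x; rewrite eu => x ex.
have ew : x = wL (v e) by rewrite -[LHS](inner_prefix_closing x (unblock B)) ex
  inner_prefix_closing.
move: ex; rewrite ew => /catI [].
by move=> /IH [B' [-> ->]]; exists B'.
Qed.

(** The expansion starts with an opening bracket, so its occurrence starts at a block boundary. *)
Lemma unblock_expand_split B z p q : z <> [::] ->
  unblock B = p ++ expand z ++ q ->
  exists B1 B2, [/\ B = B1 ++ root_blocks z ++ B2, p = unblock B1 &
    q = unblock B2].
Proof.
case: z => [//|e z] _ h; have := h; rewrite {1}/expand /= =>
  /unblock_opening_split.
move=> [B1 [B2 [eB ep e2]]].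
have /unblock_expand_prefix [B' [eB' eq]] : unblock B2 = expand (e :: z) ++ q.
  by rewrite e2 /expand /=.
by exists B1, B'; rewrite eB eB'.
Qed.

Lemma unblock_expand z B : unblock B = expand z -> B = root_blocks z.
Proof.
rewrite -[expand z]cats0 => /unblock_expand_prefix [B' [-> e]].
by case: B' e => [_|//]; rewrite cats0.
Qed.

(** * The expanded complex and its two kinds of Squier edges *)

Definition expanded_face : Type := (face K + {u : V & face (L u)})%type.
Definition expanded_top (f : expanded_face) : seq block_letter :=
  match f with inl f => expand (top f) | inr f => inners (top (projT2 f)) end.
Definition expanded_bot (f : expanded_face) : seq block_letter :=
  match f with inl f => expand (bot f) | inr f => inners (bot (projT2 f)) end.
Definition expanded_inv (f : expanded_face) : expanded_face :=
  match f with inl f => inl (finv f)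
  | inr f => inr (existT (fun u =>
    face (L u)) (projT1 f) (finv (projT2 f))) end.

Lemma expand_neq0 z : z <> [::] -> expand z <> [::].
Proof. by case: z. Qed.

Lemma inners_neq0 u (x : seq (edge (L u))) : x <> [::] -> inners x <> [::].
Proof. by case: x. Qed.

Lemma expanded_top_neq0 f : expanded_top f <> [::].
Proof.
by case: f => [f|[u f]]; [apply: expand_neq0 | apply: inners_neq0];
  exact: top_neq0.
Qed.

Lemma expanded_bot_neq0 f : expanded_bot f <> [::].
Proof.
by case: f => [f|[u f]]; [apply: expand_neq0 | apply: inners_neq0];
  exact: bot_neq0.
Qed.

Lemma expanded_invK : involutive expanded_inv.
Proof. by case=> [f|[u f]] /=; rewrite finvK. Qed.

Lemma existT_inj (T : V -> Type) u (x y : T u) :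
  existT T u x = existT T u y -> x = y.
Proof.
move=> e; have [h <-] : exists h : u = u, eq_rect u T x u h = y.
  have : exists h : u = projT1 (existT T u y),
      eq_rect u T x _ h = projT2 (existT T u y) by rewrite -e; exists erefl.
  by [].
by rewrite (Prop_irrelevance h erefl).
Qed.

Lemma expanded_inv_neq f : expanded_inv f <> f.
Proof.
case: f => [f [] /finv_neq //|[u f] /= [h]]; apply: (@finv_neq _ f).
exact: existT_inj h.
Qed.

Lemma expanded_top_inv f : expanded_top (expanded_inv f) = expanded_bot f.
Proof. by case: f => [f|[u f]] /=; rewrite top_finv. Qed.

Lemma expanded_bot_inv f : expanded_bot (expanded_inv f) = expanded_top f.
Proof. by case: f => [f|[u f]] /=; rewrite bot_finv. Qed.

Definition expansion : complex2 :=
  one_vertex_complex expanded_top_neq0 expanded_bot_neq0 expanded_invK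
    expanded_inv_neq expanded_top_inv expanded_bot_inv.

Definition expand_edge (e : redge K) : redge expansion :=
  (expand e.1.1, inl e.1.2, expand e.2).
Definition inner_edge u (p q : seq block_letter) (e : redge (L u)) :
  redge expansion :=
  (p ++ opening u :: inners e.1.1, inr (existT (fun u => face (L u)) u e.1.2),
   inners e.2 ++ closing u :: q).

Lemma rsrc_expand_edge e : rsrc (expand_edge e) = expand (rsrc e).
Proof. by rewrite /rsrc !expand_cat. Qed.

Lemma rtgt_expand_edge e : rtgt (expand_edge e) = expand (rtgt e).
Proof. by rewrite /rtgt !expand_cat. Qed.

Lemma rsrc_inner_edge u p q (e : redge (L u)) :
  rsrc (inner_edge p q e) = p ++ block_word (Block (rsrc e)) ++ q.
Proof. by rewrite /rsrc /block_word /= !inners_cat -!catA /= -?catA. Qed.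

Lemma rtgt_inner_edge u p q (e : redge (L u)) :
  rtgt (inner_edge p q e) = p ++ block_word (Block (rtgt e)) ++ q.
Proof. by rewrite /rtgt /block_word /= !inners_cat -!catA /= -?catA. Qed.

Lemma rwalk_expand_edge x y s : rwalk x s y ->
  rwalk (expand x : seq (edge expansion)) (map expand_edge s) (expand y).
Proof.
elim: s x => [x /= -> //|e s IH x /= [-> /IH]].
by rewrite rsrc_expand_edge rtgt_expand_edge.
Qed.

Lemma rwalk_inner_edge u p q x y (s : seq (redge (L u))) : rwalk x s y ->
  rwalk (p ++ block_word (Block x) ++
    q : seq (edge expansion)) (map (inner_edge p q) s)
    (p ++ block_word (Block y) ++ q).
Proof.
elim: s x => [x /= -> //|e s IH x [-> /IH]].
by rewrite [rwalk _ (map _ (_ :: _)) _]/= rsrc_inner_edge rtgt_inner_edge.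
Qed.

Lemma whisk_expand_edge p q s :
  whisk (expand p : seq (edge expansion)) (expand q) (map expand_edge s) =
  map expand_edge (whisk p q s).
Proof.
rewrite /whisk -!map_comp; apply: eq_map => -[[a f] b] /=.
by rewrite /expand_edge /= !expand_cat.
Qed.

Lemma whisk_inner_edge u a b p q (s : seq (redge (L u))) :
  whisk (a : seq (edge expansion)) b (map (inner_edge p q) s) =
    map (inner_edge (a ++ p) (q ++ b)) s.
Proof.
rewrite /whisk -!map_comp; apply: eq_map => -[[x f] y] /=.
by rewrite /inner_edge /= -!catA.
Qed.

Lemma lval_map (M M' : complex2) (H : groupType) (mu : redge M -> H)
  (h : redge M' -> redge M) s : lval mu (map h s) = lval (mu \o h) s.
Proof. by elim: s => //= e s ->. Qed.

Lemma labelling_expand_edge (H : groupType) (mu : redge expansion -> H) :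
  labelling mu -> labelling (mu \o expand_edge).
Proof.
case=> h1 h2; split=> [[[p f] q]|p f q g r] /=; first by rewrite -h1.
have := h2 (expand p) (inl f) (expand q) (inl g) (expand r).
by rewrite /expand_edge /= !expand_cat.
Qed.

Lemma labelling_inner_edge (H : groupType) (mu : redge expansion -> H) u p q :
  labelling mu -> labelling (mu \o @inner_edge u p q).
Proof.
case=> h1 h2; split=> [[[x f] y]|x f y g z] /=; first by rewrite -h1.
have := h2 (p ++ opening u :: inners x) (inr (existT _ u f)) (inners y)
  (inr (existT (fun u => face (L u)) u g)) (inners z ++ closing u :: q).
by rewrite /inner_edge /= !inners_cat -!catA.
Qed.

(** * Words homotopic to the expansion of the root *)

Definition good_blocks (B : seq block) : Prop :=
  reach w (contract B) /\
  forall b, List.In b B -> reach (wL (projT1 b)) (projT2 b).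
Definition good_word (x : seq block_letter) : Prop :=
  exists B, good_blocks B /\ x = unblock B.

Lemma good_root_blocks z : reach w z -> good_blocks (root_blocks z).
Proof.
move=> wz; split; first by rewrite contract_root_blocks.
by move=> b /List.in_map_iff [e [<- _]]; exact: reach_refl.
Qed.

Lemma good_blocks_cat3 B1 B B2 : good_blocks (B1 ++ B ++ B2) <->
  reach w (contract B1 ++ contract B ++ contract B2) /\
  [/\ forall b, List.In b B1 -> reach (wL (projT1 b)) (projT2 b),
      forall b, List.In b B -> reach (wL (projT1 b)) (projT2 b) &
      forall b, List.In b B2 -> reach (wL (projT1 b)) (projT2 b)].
Proof.
rewrite /good_blocks !contract_cat; split=> -[h h']; split=> //.
  split=> b hb; apply: h'; rewrite !List.in_app_iff; tauto.
by move=> b; rewrite !List.in_app_iff; case: h' => h1 h2 h3 [|[]]; auto.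
Qed.

(** By the parsing lemmas, a 2-cell of [K] replaces a run of root blocks, so it acts on the
    contraction, and a 2-cell of [L u] acts inside a single block. Either way the result is good
    again. *)
Lemma good_blocks_edge (e : redge expansion) B : good_blocks B ->
  rsrc e = unblock B ->
  (exists B1 f B2,
    [/\ e = (unblock B1, inl f, unblock B2),
        B = B1 ++ root_blocks (top f) ++ B2,
        good_blocks (B1 ++ root_blocks (bot f) ++ B2) &
        rtgt e = unblock (B1 ++ root_blocks (bot f) ++ B2)]) \/
  (exists u B1 (e' : redge (L u)) B2,
    [/\ e = inner_edge (unblock B1) (unblock B2) e',
        B = B1 ++ Block (rsrc e') :: B2,
        good_blocks (B1 ++ Block (rtgt e') :: B2) &
        rtgt e = unblock (B1 ++ Block (rtgt e') :: B2)]).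
Proof.
case: e => [[p [f|[u f]]] q] gB; rewrite /rsrc /= => /esym es; [left|right].
  have [B1 [B2 [eB -> ->]]] := unblock_expand_split (@top_neq0 K f) es.
  exists B1, f, B2; split=> //; last by rewrite /rtgt !unblock_cat.
  move: gB; rewrite eB !good_blocks_cat3 !contract_root_blocks =>
    -[h [h1 h2 h3]]; split.
    exact/(reach_trans h)/(reach_edge (contract B1, f, contract B2)).
  by split=> // b /List.in_map_iff [e [<- _]]; exact: reach_refl.
have [B1 [x [y [B2 [eB -> ->]]]]] := unblock_inners_split (@top_neq0 _ f) es.
exists u, B1, (x, f, y), B2; split=> //.
  move: gB; rewrite eB -[Block _ :: B2]cat1s -[Block (rtgt _) :: B2]cat1s.
  rewrite !good_blocks_cat3 => -[h [h1 h2 h3]].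
  split=> //; split=> // b [<-|//] /=.
  by apply: reach_trans (reach_edge (x, f, y)); apply: (h2 (Block _)); left.
by rewrite (rtgt_inner_edge (unblock B1) (unblock B2) (x, f, y)) unblock_cat.
Qed.

Lemma good_word_rsrc (e : redge expansion) : good_word (rsrc e) <->
  good_word (rtgt e).
Proof.
have imp (e' : redge expansion) : good_word (rsrc e') -> good_word (rtgt e').
  move=> [B [gB /(good_blocks_edge gB) [[B1 [f [B2 [_ _ g ->]]]]|]]]; first
    by exists (B1 ++ root_blocks (bot f) ++ B2).
  by move=> [u [B1 [e1 [B2 [_ _ g ->]]]]]; exists (B1 ++ Block (rtgt e1) :: B2).
by split=> [/imp //|]; rewrite -rsrc_inv => /imp; rewrite rtgt_inv.
Qed.

(** * The graph product presents the expanded complex *)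

Section Presentation.
(** [P] is the graph product, known only through its universal property. *)
Variables (G : V -> groupType) (P : groupType) (inP : forall u, G u -> P).
(** An ordered form of independence that does not ask [u] and [u'] to differ; in a rooted 2-tree
    this follows from [tree_nodup]. *)
Definition cooccur (u u' : V) : Prop :=
  exists p q r, reach w (p ++ sv u :: q ++ sv u' :: r).
Hypothesis inPM : forall u, {morph @inP u : a b / a * b}.
Hypothesis inP_comm : forall u u' (a : G u) (b : G u'), cooccur u u' ->
  inP a * inP b = inP b * inP a.
Hypothesis P_gen : forall Q : P -> Prop, Q 1 ->
  (forall a b, Q a -> Q b -> Q (a * b)) -> (forall u (a : G u), Q (inP a)) ->
  forall a, Q a.
Hypothesis P_hom : forall (H : groupType) (phi : forall u, G u -> H),
  (forall u, {morph phi u : a b / a * b}) ->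
  (forall u u' (a : G u) (b : G u'), cooccur u u' ->
     phi u a * phi u' b = phi u' b * phi u a) ->
  exists Phi : P -> H,
    {morph Phi : a b / a * b} /\ forall u (a : G u), Phi (inP a) = phi u a.
Hypothesis sv_reach : forall u, exists p q, reach w (p ++ sv u :: q).
Hypothesis w_factor : forall p q p' q' e, reach w (p ++ e :: q) ->
  reach w (p' ++ e :: q') -> reach p p' /\ reach q q'.
Hypothesis w_loop : forall (H : groupType) (mu : redge K -> H) s,
  labelling mu -> rwalk w s w -> lval mu s = 1.
Variable lam : forall u, redge (L u) -> G u.
Arguments lam : clear implicits.
Hypothesis lam_pres : forall u, presentation (wL u) (lam u).
Variable ga : forall u, seq (edge (L u)) -> seq (redge (L u)).
Arguments ga : clear implicits.
Hypothesis ga_root : forall u, ga u (wL u) = [::].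
Hypothesis ga_walk : forall u x, reach (wL u) x -> rwalk (wL u) (ga u x) x.
Hypothesis lam_ga : forall u x, reach (wL u) x -> lval (lam u) (ga u x) = 1.

Lemma inP1 u : inP (1 : G u) = 1.
Proof. by apply: (mulgI (inP (1 : G u))); rewrite -inPM !mulg1. Qed.

Lemma inPV u (a : G u) : inP a^-1 = (inP a)^-1.
Proof. by apply: (mulgI (inP a)); rewrite -inPM !mulgV inP1. Qed.

(** The runs of letters of [L u] on both sides of the 2-cell are its context inside the block, so
    the label is that of the corresponding Squier edge of [L u]. *)
Definition product_label0 (e : redge expansion) : P :=
  match e.1.2 with
  | inl _ => 1
  | inr f => inP (lam (projT1 f) (inner_suffix (projT1 f) e.1.1, projT2 f,
    inner_prefix (projT1 f) e.2))
  end.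

(** The cell relation of [product_label0] holds only at words homotopic to the
    root: elsewhere disjoint 2-cells may act on nonadjacent blocks. *)
Definition product_label (e : redge expansion) : P :=
  if pselect (good_word (rsrc e)) then product_label0 e else 1.

Lemma product_labelE (e : redge expansion) : good_word (rsrc e) ->
  product_label e = product_label0 e.
Proof. by rewrite /product_label; case: pselect. Qed.

Lemma product_label_out (e : redge expansion) : ~ good_word (rsrc e) ->
  product_label e = 1.
Proof. by rewrite /product_label; case: pselect. Qed.

Lemma product_label_expand_edge e : product_label (expand_edge e) = 1.
Proof. by rewrite /product_label; case: pselect. Qed.

Lemma product_label0_inner_edge u p q (e : redge (L u)) :
  product_label0 (inner_edge p q e) = inP (lam u e).
Proof.
by case: e => [[x f] y]; rewrite /product_label0 /= inner_suffix_opening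
  inner_prefix_closing.
Qed.

Lemma expand_rcons z : z <> [::] -> exists s u, expand z = s ++ [:: closing u].
Proof.
elim/last_ind: z => [//|z e _] _;
  exists (expand z ++ opening (v e) :: inners (wL (v e))), (v e).
by rewrite -cats1 expand_cat /expand /= cats0 /block_word /= -catA.
Qed.

Lemma inner_suffix_expand u z q r : z <> [::] ->
  inner_suffix u (r ++ expand z ++ q) = inner_suffix u q.
Proof.
move=> /expand_rcons [s [u' ->]]; rewrite -catA /= catA.
by rewrite inner_suffix_stop ?as_inner_closing.
Qed.

Lemma inner_prefix_expand u z q r : z <> [::] ->
  inner_prefix u (q ++ expand z ++ r) = inner_prefix u q.
Proof.
by case: z => [//|e z] _; rewrite /expand /= inner_prefix_stop
  ?as_inner_opening.
Qed.

Lemma product_label0_inv e : product_label0 (reinv e) = (product_label0 e)^-1.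
Proof.
case: e => [[p [f|[u f]]] q]; rewrite /product_label0 /= ?invg1 // -inPV.
by rewrite -(lab_inv (pres_lab (lam_pres u))).
Qed.

(** A 2-cell of [K] has bracketed sides, which hide its action from the context of the other cell.
    Two inner cells in one block satisfy the cell relation of [L u]; in different blocks their
    labels commute. *)
Lemma product_label0_cell (p q r : seq block_letter) (f g : face expansion) :
  good_word (p ++ top f ++ q ++ top g ++ r) ->
  product_label0 (p, f, q ++ top g ++ r) *
    product_label0 (p ++ bot f ++ q, g, r) =
  product_label0 (p ++ top f ++ q, g, r) *
    product_label0 (p, f, q ++ bot g ++ r).
Proof.
case: f g => [f|[u f]] [g|[u' g]] /=; rewrite /product_label0 /=.
- by rewrite !mulg1.
- by rewrite mul1g mulg1 !inner_suffix_expand //;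
  [exact: top_neq0 | exact: bot_neq0].
- by rewrite mul1g mulg1 !inner_prefix_expand //;
  [exact: bot_neq0 | exact: top_neq0].
move=> [B [[wB _] /esym /(unblock_inners_split (@top_neq0 _ f)) [B1 [x [y [B2
  [eB -> eq]]]]]]].
(* Either [g] starts in the remainder [y] of the block containing [f], or it starts after [y]. *)
have [k [[eq1 ek]|[eq1 ek]]] := cat_eq_cat eq; last first.
  have [y1 [y2 [_ eq1' ek']]] := map_cat_inv eq1.
  rewrite -/(inners y1) in eq1'; rewrite -ek' -/(inners y2) in ek.
  have [y3 [e3 er]] := inners_prefix (@top_neq0 _ g) (esym ek).
  have eu : u = u' by have := congr1 (@projT1 _ _) e3.
  case: u' / eu g y3 er {e3 ek eq} => g y3 ->.
  rewrite -eq1' -!inners_cat !inner_suffix_inners !catA -!inners_cat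
    !inner_prefix_closing -!inPM -!catA.
  by rewrite (lab_cell (pres_lab (lam_pres u))).
(* The top of [g] cannot start with the closing bracket of the block of [f], so [g] lies in a later
   block. *)
case: k ek eq1 => [|a k] /= ek.
  have := @top_neq0 _ g; case: (pseq (top g)) ek => [//|c s] e.
  by have := congr1 (inner_prefix u') e;
    rewrite /= as_inner_closing as_inner_inl.
case: ek => <- /(unblock_inners_split (@top_neq0 _ g)) [B3 [x' [y' [B4 [eB2 _
  _]]]]] ->.
have sufE s t : inner_suffix u' (s ++ t ++ inners y ++ closing u :: k) =
  inner_suffix u' k.
  by rewrite !catA inner_suffix_stop ?as_inner_closing.
have preE s : inner_prefix u ((inners y ++ closing u :: k) ++ s) = y
  by rewrite -catA /= inner_prefix_closing.
rewrite !preE !sufE; apply: inP_comm.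
by move: wB; rewrite eB eB2 !contract_cat /= contract_cat;
  exists (contract B1), (contract B3), (contract B4).
Qed.

(** By [good_word_rsrc], the four edges of a cell all start at good words or none does; in the
    second case all labels are [1]. *)
Lemma product_label_labelling : labelling product_label.
Proof.
split=> [e|p f q g r].
  have [h|n] := pselect (good_word (rsrc e)).
    by rewrite !product_labelE ?rsrc_inv -?good_word_rsrc // product_label0_inv.
  by rewrite !product_label_out ?invg1 // rsrc_inv -good_word_rsrc.
pose e1 : redge expansion := (p, f, q ++ pseq (top g) ++ r).
pose e2 : redge expansion := (p ++ pseq (bot f) ++ q, g, r).
pose e3 : redge expansion := (p, f, q ++ pseq (bot g) ++ r).
pose e4 : redge expansion := (p ++ pseq (top f) ++ q, g, r).
have g12 : good_word (rsrc e1) <-> good_word (rsrc e2).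
  by rewrite good_word_rsrc /rsrc /rtgt /= -!catA.
have g14 : good_word (rsrc e1) <-> good_word (rsrc e4)
  by rewrite /rsrc /= -!catA.
have g43 : good_word (rsrc e4) <-> good_word (rsrc e3).
  by rewrite good_word_rsrc /rsrc /rtgt /= -!catA.
have [h|n] := pselect (good_word (rsrc e1)).
  rewrite !product_labelE; [exact: product_label0_cell| | | |]; tauto.
by rewrite !product_label_out //; tauto.
Qed.

Lemma lval_product_label_expand s : lval product_label (map expand_edge s) = 1.
Proof. by elim: s => //= e s ->; rewrite product_label_expand_edge mulg1. Qed.

Lemma lval_product_label_inner u p q x y (s : seq (redge (L u))) :
  reach w (p ++ sv u :: q) -> reach (wL u) x -> rwalk x s y ->
  lval product_label (map (inner_edge (expand p) (expand q)) s) =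
    inP (lval (lam u) s).
Proof.
move=> wpq wx; elim: s x wx => [x _ _|e s IH x wx [ex es]]; first
  by rewrite inP1.
have he : good_word (rsrc (inner_edge (expand p) (expand q) e)).
  exists (root_blocks p ++ Block x :: root_blocks q); split; last
    by rewrite rsrc_inner_edge unblock_cat -ex.
  rewrite -[Block x :: _]cat1s; apply/good_blocks_cat3;
    rewrite !contract_root_blocks; split=> //.
  split=> b; rewrite ?List.in_map_iff.
  - by move=> [e' [<- _]]; exact: reach_refl.
  - by move=> [<-|].
  - by move=> [e' [<- _]]; exact: reach_refl.
rewrite [LHS]/= product_labelE // product_label0_inner_edge (IH (rtgt e)) ?inPM
  //.
by apply: reach_trans wx _; rewrite ex; exact: reach_edge.
Qed.

(** For a generator: move in [K] to a path through [sv u], run inside that block a loop representing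
    the element, and return. Both outer legs have value [1]. *)
Lemma product_label_surj a :
  exists s, rwalk (expand w : seq (edge expansion)) s (expand w) /\
    lval product_label s = a.
Proof.
move: a; apply: P_gen => [|a b [s [ws <-]] [t [wt <-]]|u a]; first
  by exists [::].
  by exists (s ++ t); rewrite lval_cat; split=> //; apply: rwalk_cat ws wt.
have [p [q wpq]] := sv_reach u; have [d wd] := wpq.
have [s [ws <-]] := pres_surj (lam_pres u) a.
have h1 := rwalk_expand_edge wd; have h2 :=
  rwalk_inner_edge (expand p) (expand q) ws.
rewrite expand_cat expand_sv in h1.
exists (map expand_edge d ++ map (inner_edge (expand p) (expand q)) s ++
  rinv (map expand_edge d)); split.
  exact/(rwalk_cat h1)/(rwalk_cat h2)/rwalk_inv.
rewrite !lval_cat (lval_inv product_label_labelling) lval_product_label_expand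
  invg1 mul1g mulg1.
exact: lval_product_label_inner wpq (reach_refl _) ws.
Qed.

(** A path from the expansion of [contract B] to [unblock B]: each block is filled along [ga] while
    those to its right are still root blocks. *)
Fixpoint fill (B : seq block) : seq (redge expansion) :=
  if B is b :: B' then
    map (inner_edge [::] (expand (contract B'))) (ga (projT1 b) (projT2 b)) ++
    whisk (block_word b : seq (edge expansion)) [::] (fill B')
  else [::].

Lemma rwalk_fill B :
  (forall b, List.In b B -> reach (wL (projT1 b)) (projT2 b)) ->
  rwalk (expand (contract B) : seq (edge expansion)) (fill B) (unblock B).
Proof.
elim: B => [//|[u x] B IH] hB.
have hx : reach (wL u) x by apply: (hB (Block x)); left.
have h1 := rwalk_inner_edge [::] (expand (contract B)) (ga_walk hx).
have h2 := rwalk_whisk (block_word (Block x) : seq (edge expansion)) [::]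
  (IH (fun b hb => hB b (or_intror hb))).
rewrite !cats0 in h2.
rewrite [contract _]/= expand_sv; exact: rwalk_cat h1 h2.
Qed.

Lemma fill_cat B B' : fill (B ++ B') =
  whisk ([::] : seq (edge expansion)) (expand (contract B')) (fill B) ++
  whisk (unblock B : seq (edge expansion)) [::] (fill B').
Proof.
elim: B => [|b B IH] /=; first by rewrite whisk0.
rewrite IH !whisk_cat whisk_inner_edge !whisk_whisk /= contract_cat expand_cat.
by rewrite !cats0 -[RHS]catA.
Qed.

Lemma fill_root_blocks z : fill (root_blocks z) = [::].
Proof. by elim: z => //= e z ->; rewrite ga_root. Qed.

(** * Recovering an arbitrary labelling from the product label *)

Section Injectivity.
Variables (H : groupType) (mu : redge expansion -> H).
Hypothesis muP : labelling mu.

Lemma lval_expand_walk x s t : rwalk w s x -> rwalk w t x ->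
  lval mu (map expand_edge s) = lval mu (map expand_edge t).
Proof.
move=> ws wt; have muP' := labelling_expand_edge muP.
apply: (mulIg (lval mu (map expand_edge t))^-1); rewrite mulgV !lval_map.
rewrite -(lval_inv muP') -lval_cat; apply: w_loop => //.
exact/(rwalk_cat ws)/rwalk_inv.
Qed.

Definition conj_loop u p q (d : seq (redge K)) (s : seq (redge (L u))) : H :=
  lval mu (map expand_edge d) *
  lval mu (map (inner_edge (expand p) (expand q)) s) *
  (lval mu (map expand_edge d))^-1.

(** By [w_factor], one path is carried to the other by moves in [K] to the left and to the right of
    the block [u]. These are disjoint from the block, so they commute with [s]. *)
Lemma conj_loop_indep u p q d p' q' d' (s : seq (redge (L u))) :
  rwalk w d (p ++ sv u :: q) -> rwalk w d' (p' ++ sv u :: q') ->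
  rwalk (wL u) s (wL u) -> conj_loop p q d s = conj_loop p' q' d' s.
Proof.
move=> wd wd' ws.
have [[a pa] [b qb]] := w_factor (ex_intro _ d wd : reach _ _) (ex_intro _ d'
  wd' : reach _ _).
have ha := rwalk_whisk [::] (sv u :: q) pa.
have hb := rwalk_whisk (p' ++ [:: sv u]) [::] qb.
rewrite !cats0 -!catA in hb.
(* Walks in [K] from the root to the same word have equal values, so [d'] may be traded for [d]
   followed by the two side moves. *)
rewrite /conj_loop -(lval_expand_walk (rwalk_cat wd (rwalk_cat ha hb)) wd').
rewrite !map_cat !lval_cat -!whisk_expand_edge expand_sv.
set D := lval mu (map expand_edge d).
have hs := rwalk_inner_edge [::] [::] ws.
have e1 := lval_interchange muP [::] [::] (expand q) (rwalk_expand_edge pa) hs.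
have e2 := lval_interchange muP (expand p') [::] [::] hs (rwalk_expand_edge qb).
rewrite /= !cats0 !whisk_inner_edge /= !cats0 in e1 e2.
set A := lval mu (whisk _ _ (map expand_edge a)) in e1 *.
have -> : expand (p' ++ [:: sv u]) = expand p' ++ block_word (Block (wL u)).
  by rewrite expand_cat expand_sv cats0.
set B := lval mu (whisk _ _ (map expand_edge b)) in e2 *.
rewrite !invgM -!mulgA; congr (_ * _).
by rewrite !mulgA -(mulgA A B) -e2 !mulgA e1 mulgK mulgK.
Qed.

(** Each [phi u] is defined on one chosen path through [u] and computed on any other by
    [conj_loop_indep]; for commutation, both loops are placed on a common path. *)
Lemma conj_loop_hom : exists phi : forall u, G u -> H,
  [/\ forall u, {morph phi u : a b / a * b},
      forall u u' (a : G u) (b : G u'), cooccur u u' ->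
        phi u a * phi u' b = phi u' b * phi u a &
      forall u p q d s, rwalk w d (p ++ sv u :: q) -> rwalk (wL u) s (wL u) ->
        phi u (lval (lam u) s) = conj_loop p q d s].
Proof.
have /dep_choice[phi phiP] : forall u, exists phi : G u -> H,
    {morph phi : a b / a * b} /\
    forall p q d s, rwalk w d (p ++ sv u :: q) -> rwalk (wL u) s (wL u) ->
      phi (lval (lam u) s) = conj_loop p q d s.
  move=> u; have [p [q [d wd]]] := sv_reach u.
  have [f [fM fE]] := presentation_hom (lam_pres u)
    (labelling_inner_edge u (expand p) (expand q) muP).
  exists (fun a => lval mu (map expand_edge d) * f a *
    (lval mu (map expand_edge d))^-1).
  split=> [a b|p' q' d' s wd' ws]; first by rewrite fM !mulgA mulgVK.
  by rewrite fE // -lval_map; exact: (conj_loop_indep wd wd' ws).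
exists phi; split=> [u|u u' a b|u p q d s];
  [exact: (phiP u).1| |exact: (phiP u).2].
move=> [p [q [r [d wd]]]].
have [s [ws <-]] := pres_surj (lam_pres u) a.
have [t [wt <-]] := pres_surj (lam_pres u') b.
have wd' : rwalk w d ((p ++ sv u :: q) ++ sv u' :: r) by rewrite -catA.
rewrite ((phiP u).2 _ _ _ _ wd ws) ((phiP u').2 _ _ _ _ wd' wt) /conj_loop.
have := lval_interchange muP (expand p) (expand q) (expand r)
  (rwalk_inner_edge [::] [::] ws) (rwalk_inner_edge [::] [::] wt).
rewrite !whisk_inner_edge /= !cats0 => e.
rewrite !mulgA !mulgVK -!(mulgA (lval mu (map expand_edge d))).
by rewrite !expand_cat !expand_sv; congr (_ * (_ * _)); exact: e.
Qed.

(** The value of a path from the root to [unblock B]: first move in [K]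
    to the contraction of [B], then fill the blocks from left to right. *)
Definition canonical (de : seq (edge K) -> seq (redge K)) (B : seq block) : H :=
  lval mu (map expand_edge (de (contract B))) * lval mu (fill B).

(** Along every edge between good words, [Phi] of the label equals [mu] conjugated by the canonical
    values at its two ends. On a loop at the root both ends agree, so label value [1] forces
    [mu]-value [1]. *)
Lemma product_label_inj s :
  rwalk (expand w : seq (edge expansion)) s (expand w) ->
  lval product_label s = 1 -> lval mu s = 1.
Proof.
have [phi [phiM phiC phiE]] := conj_loop_hom.
have [Phi [PhiM PhiE]] := P_hom phiM phiC.
have Phi1 : Phi 1 = 1 by apply: (mulgI (Phi 1)); rewrite -PhiM !mulg1.
have /choice[de deP] : forall x, exists d, reach w x -> rwalk w d x.
  by move=> x; have [[d]|n] := pselect (reach w x); [exists d | exists [::]].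
have step (e : redge expansion) B : good_blocks B -> rsrc e = unblock B ->
  exists B',
    [/\ good_blocks B', rtgt e = unblock B' &
      Phi (product_label e) * canonical de B' = canonical de B * mu e].
  move=> gB es; have ge : good_word (rsrc e) by exists B.
  rewrite product_labelE //.
  case: (good_blocks_edge gB es) => [[B1 [f [B2 [ee eB gB' et]]]]|
                             [u [B1 [e' [B2 [ee eB gB' et]]]]]].
    exists (B1 ++ root_blocks (bot f) ++ B2); split=> //.
    rewrite ee eB in gB *; rewrite /product_label0 /= Phi1 mul1g.
    have [wz [/rwalk_fill h1 _ /rwalk_fill h2]] :=
      (good_blocks_cat3 _ _ _).1 gB.
    rewrite contract_root_blocks in wz.
    have fillE z : lval mu (fill (B1 ++ root_blocks z ++ B2)) =
        lval mu (whisk ([::] : seq (edge expansion)) (expand z ++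
          expand (contract B2)) (fill B1)) *
        lval mu (whisk (unblock B1 ++ expand z : seq (edge expansion)) [::]
          (fill B2)).
      by rewrite !fill_cat fill_root_blocks contract_cat contract_root_blocks
        expand_cat whisk_whisk lval_cat.
    have fs : rwalk (expand (top f) : seq (edge expansion)) [:: ([::], inl f,
      [::])] (expand (bot f)).
      by rewrite /= /rsrc /rtgt /= !cats0.
    (* The move [f] is pulled back past the filling of [B2] and then that of [B1], to a point where
       only root blocks are present. *)
    have e1 := lval_interchange muP (unblock B1) [::] [::] fs h2.
    have e2 := lval_interchange muP [::] [::] (expand (contract B2)) h1 fs.
    rewrite /= !cats0 !mulg1 in e1 e2.
    rewrite /canonical !fillE !contract_cat !contract_root_blocks -!mulgA -e1
      !mulgA.
    have wd := deP _ wz.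
    have we : rwalk (contract B1 ++ top f ++
      contract B2) [:: (contract B1, f, contract B2)]
       (contract B1 ++ bot f ++ contract B2) by [].
    have wd' := deP _ (reach_trans wz (reach_edge (contract B1, f,
      contract B2))).
    (* The chosen walk to the new contraction is replaced by the old one followed by [f]. *)
    rewrite -(lval_expand_walk (rwalk_cat wd we) wd') map_cat lval_cat /= mulg1.
    rewrite -!mulgA; congr (_ * _); rewrite !mulgA; congr (_ * _).
    exact: esym.
  exists (B1 ++ Block (rtgt e') :: B2); split=> //.
  rewrite ee eB in gB *; rewrite product_label0_inner_edge PhiE.
  have [wz [/rwalk_fill h1 hm /rwalk_fill h2]] :=
    (good_blocks_cat3 B1 [:: _] B2).1 gB.
  have {hm}hx : reach (wL u) (rsrc e') by apply: (hm (Block _)); left.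
  have hy := reach_trans hx (reach_edge e').
  have wx := ga_walk hx; have wy := ga_walk hy.
  have we : rwalk (rsrc e') [:: e'] (rtgt e') by [].
  have fillE x : lval mu (fill (B1 ++ Block x :: B2)) =
      lval mu (whisk ([::] : seq (edge expansion)) (block_word (Block (wL u)) ++
        expand (contract B2)) (fill B1)) *
      lval mu (map (inner_edge (unblock B1) (expand (contract B2))) (ga u x)) *
      lval mu (whisk (unblock B1 ++ block_word (Block x) : seq (edge expansion))
        [::] (fill B2)).
    rewrite fill_cat [contract (_ :: _)]/= expand_sv lval_cat -mulgA;
      congr (_ * _).
    by rewrite /= whisk_cat whisk_inner_edge whisk_whisk lval_cat !cats0.
  (* The edge is closed to a loop at [wL u] so that [phiE] applies; since [lam] is trivial along
     [ga], the loop has the label of [e']. *)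
  pose l := ga u (rsrc e') ++ [:: e'] ++ rinv (ga u (rtgt e')).
  have wl : rwalk (wL u) l (wL u).
    exact/(rwalk_cat wx)/(rwalk_cat we)/rwalk_inv.
  have el : lval (lam u) l = lam u e'.
    rewrite !lval_cat (lval_inv (pres_lab (lam_pres u))) !lam_ga // invg1.
    by rewrite /= mul1g !mulg1.
  (* The edge [e'] commutes with the filling of [B2], and the loop [l] with that of [B1]. *)
  have e1 := lval_interchange muP (unblock B1) [::] [::]
    (rwalk_inner_edge [::] [::] we) h2.
  have e2 := lval_interchange muP [::] [::] (expand (contract B2)) h1
    (rwalk_inner_edge [::] [::] wl).
  rewrite !whisk_inner_edge /= !cats0 in e1 e2.
  have el' : lval mu (map (inner_edge (unblock B1) (expand (contract B2))) l) =
      lval mu (map (inner_edge (unblock B1) (expand (contract B2))) (ga u (rsrc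
        e'))) *
      mu (inner_edge (unblock B1) (expand (contract B2)) e') *
      (lval mu (map (inner_edge (unblock B1) (expand (contract B2))) (ga u (rtgt
        e'))))^-1.
    rewrite /l !lval_map !lval_cat (lval_inv (labelling_inner_edge _ _ _ muP))
      /=.
    by rewrite mulg1 mulgA.
  rewrite -el (phiE _ _ _ _ _ (deP _ wz) wl) /conj_loop /canonical !fillE
    !contract_cat /=.
  rewrite -!mulgA mulKg; congr (_ * _); rewrite !mulg1 in e1; rewrite -e1.
  by rewrite !mulgA -e2 el' !mulgA mulgVK.
have walk s' B y : good_blocks B ->
  rwalk (unblock B : seq (edge expansion)) s' y -> exists B',
    [/\ good_blocks B', y = unblock B' &
      Phi (lval product_label s') * canonical de B' = canonical de B *
        lval mu s'].
  elim: s' B => [|e s' IH] B gB /=.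
    by move=> <-; exists B; rewrite Phi1 mul1g mulg1.
  case=> /esym es es'; have [B1 [gB1 et e1]] := step e B gB es.
  rewrite et in es'; have [B2 [gB2 ey e2]] := IH _ gB1 es'.
  by exists B2; split=> //; rewrite PhiM -mulgA e2 mulgA e1 mulgA.
move=> ws s1; have [B [gB /esym /unblock_expand eB]] :=
  walk s (root_blocks w) _ (good_root_blocks (reach_refl w)) ws.
rewrite s1 Phi1 mul1g eB => e; apply: (mulgI (canonical de (root_blocks w))).
by rewrite mulg1 -e.
Qed.

End Injectivity.

Lemma product_label_presentation :
  presentation (expand w : seq (edge expansion)) product_label.
Proof.
split; [exact: product_label_labelling | exact: product_label_surj | move=> H mu
  muP s].
exact: product_label_inj.
Qed.

End Presentation.
End Blocks.

Theorem theorem2p4 (K : complex2) (w : nepath K) :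
  rooted_2tree w -> appropriate (independence_graph w).
Proof.
move=> tree G dG.
have /dep_choice[L /dep_choice[wL iso]] : forall u, exists (Lu : complex2)
  (wu : nepath Lu), isomorphic (G u) (diagram_group wu) := dG.
have /dep_choice[lam /dep_choice[ga sp]] u : exists (lam : redge (L u) ->
  G u) ga,
    [/\ ga (pseq (wL u)) = [::],
        forall x, reach (pseq (wL u)) x -> rwalk (pseq (wL u)) (ga x) x,
        forall x, reach (pseq (wL u)) x -> lval lam (ga x) = 1 &
        presentation (pseq (wL u)) lam].
  have [lam0 /(isomorphic_presentation (iso u)) [lam P]] :=
    diagram_group_presentation (wL u).
  exact: presentation_spanning P.
pose sv (u : indep_vert w) := sval u.
(* By [tree_edge] every edge of [K] is a vertex of the independence graph, so [v] is total and
   inverse to [sv]. *)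
pose v (e : edge K) : indep_vert w := exist _ e (tree_edge tree e).
have vK : cancel v sv by [].
have svK : cancel sv v by case=> e h; congr exist; exact: Prop_irrelevance.
have [spR spW sp1 spP] : [/\ forall u, ga u (pseq (wL u)) = [::],
    forall u x, reach (pseq (wL u)) x -> rwalk (pseq (wL u)) (ga u x) x,
    forall u x, reach (pseq (wL u)) x -> lval (lam u) (ga u x) = 1 &
    forall u, presentation (pseq (wL u)) (lam u)].
  by split=> u; case: (sp u).
have pres := product_label_presentation vK svK (@gp_inM (independence_graph w)
  G)
  _ (@gp_ind (independence_graph w) G) _ (@indep_vert_reach K w)
  (tree_factor tree) (tree_loop tree) spP spR spW sp1.
pose P : nepath (expansion v (fun u => pseq (wL u)) ) :=
  @NePath _ (one_vertex_path (expand v (fun u => pseq (wL u)) w))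
    (expand_neq0 (@np_neq0 K w)).
have [lamP presP] := diagram_group_presentation P.
(* The graph product and the diagram group at [P] are presented by loops at the same word. *)
exists _, P; apply: (presentation_isomorphic (pres _ _) presP).
- by move=> u u' a b [p [q [r h]]]; apply/gp_in_comm/(tree_adj tree h).
move=> H phi phiM phiC; apply: gp_hom => // u u' a b.
(* Adjacency leaves open which edge comes first, whereas [cooccur] is ordered. *)
by case/adj_reach=> p [q [r [h|h]]]; [|symmetry]; apply: phiC; exists p, q, r.
Qed.
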